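(* Suppose that the stores in $\mathcal S$ satisfy: $\overline E_i/P_i$ is the same for all $i\in\mathcal S$; $P'_i=\alpha P_i$ for all $i$, for some constant $\alpha>0$; all stores have a common round-trip efficiency $\eta\in(0,1]$; and $E_i(0)/P_i$ is the same for all $i$. Then for every $T\in(0,\infty]$ and every locally integrable demand function $(d(t),\,t\ge0)$ (of either sign), the GGDDF/GGCDF policy minimises the unserved energy $\int_0^T\max\bigl(d(t)-\sum_{i}r_i(t),0\bigr)dt$ among all admissible policies. Consequently, for a random demand process, the GGDDF/GGCDF policy (which is non-anticipatory) minimises the expected unserved energy over $[0,T]$ among all non-anticipatory admissible policies.
   Context: A finite set $\mathcal S$ of energy stores is given. Store $i$ has capacity $\overline E_i>0$, maximum discharge rate $P_i>0$, maximum charge rate $P'_i\ge0$, and all stores have the same round-trip efficiency $\eta\in(0,1]$. The demand $d(t)$ may take either sign; negative values represent an external energy surplus available for charging. An admissible policy is a choice of measurable rates $r_i(t)$ with $E_i(t)=E_i(0)-\int_0^tr_i(u)\,du$, $0\le E_i(t)\le\overline E_i$, $-P'_i\le r_i(t)\le P_i$, and $$\min(d(t),0)\le\sum_{i:\,r_i(t)\ge0}r_i(t)+\frac1\eta\sum_{i:\,r_i(t)<0}r_i(t)\le\max(d(t),0)\quad\text{for all }t\ge0$$ (cross-charging between stores is allowed; a store charged at internal rate $-r_i$ draws energy at rate $-r_i/\eta$). Non-anticipatory means the rates at time $t$ depend only on $(d(s),\,s\le t)$. GGDDF/GGCDF policy: at times $t$ with $d(t)\ge0$, use the GGDDF rule: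 the total served rate is $\bar d(t)=\min\bigl(d(t),\sum_{i:E_i(t)>0}P_i\bigr)$; the nonempty stores are grouped by equal discharge-duration $E_i(t)/P_i$, groups taken in decreasing order of duration, all stores in earlier groups discharge at rate $P_i$, stores in the last needed group discharge at rate $\lambda P_i$ ($\lambda\in(0,1]$) so that the total is $\bar d(t)$, others are idle. At times with $d(t)<0$, use the analogous GGCDF (greedy greatest-charge-duration-first) rule: the total internal charging rate is $c(t)=\min\bigl(\eta|d(t)|,\sum_{i:E_i(t)<\overline E_i}P'_i\bigr)$; the non-full stores are grouped by equal charge-duration $(\overline E_i-E_i(t))/P'_i$, groups taken in decreasing order of charge-duration, stores in earlier groups charge at rate $P'_i$ (i.e. $r_i=-P'_i$), stores in the last needed group charge at rate $\lambda P'_i$ ($\lambda\in(0,1]$) so the total internal charging rate is $c(t)$, others are idle. *)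

(* Defs.v *)
From HB Require Import structures.
From mathcomp Require Import all_boot all_order all_algebra.
From mathcomp Require Import all_classical all_reals all_analysis.
Set Implicit Arguments. Unset Strict Implicit. Unset Printing Implicit Defensive.
Import Order.TTheory GRing.Theory Num.Theory.
Local Open Scope classical_set_scope.
Local Open Scope ring_scope.

Definition interval0 (R : realType) (t : R) : set R := [set s | 0 <= s <= t].

Definition horizon (R : realType) (T : \bar R) : set R :=
  [set s | 0 <= s /\ (s%:E <= T)%E].

Definition loc_integrable (R : realType) (d : R -> R) : Prop :=
  forall t : R, 0 <= t ->
    (@lebesgue_measure R).-integrable (interval0 t) (EFin \o d).

Definition is_policy (R : realType) (I : finType) (r : I -> R -> R) : Prop :=
  forall i, measurable_fun [set t : R | 0 <= t] (r i).

Definition energy (R : realType) (I : finType) (E0 : I -> R)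
  (r : I -> R -> R) (i : I) (t : R) : R :=
  E0 i - Rintegral (@lebesgue_measure R) (interval0 t) (r i).

Definition net_rate (R : realType) (I : finType) (eta : R) (x : I -> R) : R :=
  \sum_(i | 0 <= x i) x i + eta^-1 * \sum_(i | x i < 0) x i.

Definition admissible (R : realType) (I : finType) (Ebar P P' : I -> R)
  (eta : R) (E0 : I -> R) (d : R -> R) (r : I -> R -> R) : Prop :=
  is_policy r /\
  forall t : R, 0 <= t ->
    [/\ forall i, 0 <= energy E0 r i t <= Ebar i,
        forall i, - P' i <= r i t <= P i &
        Num.min (d t) 0 <= net_rate eta (fun i => r i t) <= Num.max (d t) 0].

(* GGDDF rule at one instant, given energies E, demand dt >= 0, rates x:
   nonempty stores with discharge duration E_i/P_i > tau discharge at P_i,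
   those with duration = tau (the last needed group) at lam * P_i,
   all others idle; total = min(dt, sum of P_i over nonempty stores). *)
Definition ggddf_rates (R : realType) (I : finType) (P : I -> R)
  (E : I -> R) (dt : R) (x : I -> R) : Prop :=
  exists tau lam : R, 0 < lam <= 1 /\
    (forall i, x i =
       if (0 < E i) && (tau < E i / P i) then P i
       else if (0 < E i) && (E i / P i == tau) then lam * P i
       else 0) /\
    \sum_i x i = Num.min dt (\sum_(i | 0 < E i) P i).

(* GGCDF rule at one instant (dt < 0): non-full stores with charge duration
   (Ebar_i - E_i)/P'_i > tau charge at P'_i, those with duration = tau at
   lam * P'_i, others idle; total internal charging rate
   = min(eta |dt|, sum of P'_i over non-full stores). *)
Definition ggcdf_rates (R : realType) (I : finType) (Ebar P' : I -> R)
  (eta : R) (E : I -> R) (dt : R) (x : I -> R) : Prop :=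
  exists tau lam : R, 0 < lam <= 1 /\
    (forall i, x i =
       if (E i < Ebar i) && (tau < (Ebar i - E i) / P' i) then - P' i
       else if (E i < Ebar i) && ((Ebar i - E i) / P' i == tau)
            then - (lam * P' i)
       else 0) /\
    - \sum_i x i = Num.min (eta * `|dt|) (\sum_(i | E i < Ebar i) P' i).

Definition gg_policy (R : realType) (I : finType) (Ebar P P' : I -> R)
  (eta : R) (E0 : I -> R) (d : R -> R) (r : I -> R -> R) : Prop :=
  is_policy r /\
  forall t : R, 0 <= t ->
    (0 <= d t -> ggddf_rates P (fun i => energy E0 r i t) (d t)
                             (fun i => r i t)) /\
    (d t < 0 -> ggcdf_rates Ebar P' eta (fun i => energy E0 r i t) (d t)
                            (fun i => r i t)).

Definition unserved (R : realType) (I : finType) (T : \bar R) (d : R -> R)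
  (r : I -> R -> R) : \bar R :=
  (\int[@lebesgue_measure R]_(t in horizon T)
     (Num.max (d t - \sum_i r i t) 0)%:E)%E.

Definition nonanticipatory (R : realType) (I : finType)
  (pi : (R -> R) -> I -> R -> R) : Prop :=
  forall (d1 d2 : R -> R) (t : R), 0 <= t ->
    (forall s, 0 <= s <= t -> d1 s = d2 s) ->
    forall i, pi d1 i t = pi d2 i t.

(* Main.v *)
(* All durations E_i / P_i stay equal under the greedy policy, so the stores act
   as one store whose energy e follows a clipped input, blocked at empty and at
   full.

   Optimality: let D be the rival's excess stored energy and g its excess
   unserved energy. While the greedy store is not full, g - D is nondecreasing;
   while it is not empty, g is nondecreasing. Since e is Lipschitz, time splits
   into steps of fixed length with one of the two regimes in each, and
   g >= max(D, 0) propagates from step to step. Cross-charging does not help the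
   rival, because eta <= 1.

   Existence: with X the unblocked energy and Y s = sup_(u <= s) (- X u)^+
   Skorokhod's regulator, X + Y solves the problem blocked at empty only. A
   chain rule for X + Y shows that Y has the density - f on the set where
   X + Y = 0, f being the input. As the state moves little in a short time,
   alternating this one-sided solution with its mirror image at full yields the
   two-sided one, which is unique by comparison; uniqueness lets the rates at
   time t be computed from the demand stopped at t. *)
Require Import Defs.
From HB Require Import structures.
From mathcomp Require Import all_boot all_order all_algebra.
From mathcomp Require Import all_classical all_reals all_analysis.
From mathcomp Require Import measurable_realfun ring lra.
Set Implicit Arguments. Unset Strict Implicit. Unset Printing Implicit Defensive.
Import Order.TTheory GRing.Theory Num.Theory.
Import numFieldNormedType.Exports.
Local Open Scope classical_set_scope.
Local Open Scope ring_scope.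

(** * Antiderivatives of bounded functions *)

Section Antiderivatives.
Context {R : realType}.
Local Notation mu := (@lebesgue_measure R).
Local Notation Rnneg := [set t : R | 0 <= t].
Implicit Types (F G psi phi : R -> R) (L M a b c s t : R).

Lemma nneg_itv : Rnneg = `[0, +oo[%classic.
Proof. by apply/seteqP; split => x /=; rewrite in_itv/= andbT. Qed.

Lemma measurable_nneg : measurable Rnneg.
Proof. by rewrite nneg_itv; exact: measurable_itv. Qed.

Lemma interval0E (t : R) : interval0 t = `[0, t]%classic.
Proof. by apply/seteqP; split => x /=; rewrite in_itv. Qed.

Lemma itv_sub_nneg (b1 b2 : bool) (s t : R) : 0 <= s ->
  [set` Interval (BSide b1 s) (BSide b2 t)] `<=` Rnneg.
Proof.
move=> s0 x /=; rewrite in_itv/= => /andP[+ _].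
by case: b1 => /= sx; [exact: le_trans sx|exact: le_trans (ltW sx)].
Qed.

(** The differential equation in integral form, with a density defined at every instant rather than
    up to null sets, so that pointwise sign conditions on rates can be used directly. [L] serves as
    a Lipschitz constant of [F]. *)
Definition has_density (F psi : R -> R) (L : R) : Prop :=
  [/\ measurable_fun Rnneg psi,
      forall t, 0 <= t -> `|psi t| <= L &
      forall t, 0 <= t -> F t = F 0 + \int[mu]_(s in interval0 t) psi s].

Lemma bounded_integrable (psi : R -> R) (L : R) (b1 b2 : bool) (s t : R) :
  measurable_fun Rnneg psi -> (forall t, 0 <= t -> `|psi t| <= L) -> 0 <= s ->
  mu.-integrable [set` Interval (BSide b1 s) (BSide b2 t)] (EFin \o psi).
Proof.
move=> mpsi bpsi s0; apply: measurable_bounded_integrable => //.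
- rewrite /= lebesgue_measure_itv/=; case: ifP => _; last by rewrite ltry.
  by rewrite -EFinB ltry.
- by apply: measurable_funS mpsi; [exact: measurable_nneg|exact: itv_sub_nneg].
- exists L; split; first exact: num_real.
  move=> x Lx y yst; apply: (le_trans _ (ltW Lx)); apply: bpsi.
  exact: itv_sub_nneg yst.
Qed.

Lemma density_incr F psi L s t : has_density F psi L -> 0 <= s -> s <= t ->
  F t - F s = \int[mu]_(u in `]s, t]) psi u.
Proof.
move=> [mpsi bpsi FE] s0 st; rewrite (FE _ (le_trans s0 st)) (FE _ s0).
rewrite !interval0E opprD addrACA subrr add0r Rintegral_itvB//.
exact: bounded_integrable mpsi bpsi _.
Qed.

Lemma Rintegral_itv_cst (s t c : R) : s <= t ->
  \int[mu]_(u in `]s, t]) c = c * (t - s).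
Proof.
move=> st; rewrite Rintegral_cst; last exact: measurable_itv.
congr (_ * _); rewrite /= lebesgue_measure_itv/= lte_fin.
case: ltP => [_|ts] //=.
by have -> : s = t by [apply/eqP; rewrite eq_le st ts]; rewrite subrr.
Qed.

Lemma cst_integrable (c : R) (b1 b2 : bool) (s t : R) : 0 <= s ->
  mu.-integrable [set` Interval (BSide b1 s) (BSide b2 t)] (EFin \o cst c).
Proof.
by move=> s0; apply: (@bounded_integrable _ `|c|) => //; exact: measurable_cst.
Qed.

Lemma density_incr_bounds F psi L a b s t : has_density F psi L ->
  0 <= s -> s <= t -> (forall u, s < u <= t -> a <= psi u <= b) ->
  a * (t - s) <= F t - F s <= b * (t - s).
Proof.
move=> dF s0 st ab; rewrite (density_incr dF)//; case: dF => mpsi bpsi _.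
rewrite -!Rintegral_itv_cst//; apply/andP; split; apply: le_Rintegral => //;
  try exact: measurable_itv; try exact: cst_integrable;
  try exact: bounded_integrable mpsi bpsi _;
  by move=> x /=; rewrite in_itv/= => /ab/andP[].
Qed.

Lemma density_mono F psi L s t : has_density F psi L -> 0 <= s -> s <= t ->
  (forall u, s < u <= t -> 0 <= psi u) -> F s <= F t.
Proof.
move=> dF s0 st psi0.
have := density_incr_bounds (a := 0) (b := L) dF s0 st.
case: (dF) => _ bpsi _ H; rewrite -subr_ge0.
suff /H/andP[] : forall u, s < u <= t -> 0 <= psi u <= L by rewrite mul0r.
move=> u /[dup] sut /psi0 ->/=; case/andP: sut => su ut.
by apply: (le_trans (ler_norm _)); apply: bpsi; apply: (le_trans s0); exact: ltW.
Qed.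

Lemma density_lip F psi L s t : has_density F psi L -> 0 <= s -> s <= t ->
  `|F t - F s| <= L * (t - s).
Proof.
move=> dF s0 st; rewrite ler_norml -mulNr.
apply: (density_incr_bounds dF) => // u /andP[su _]; rewrite -ler_norml.
by case: dF => _ bpsi _; apply: bpsi; apply: (le_trans s0); exact: ltW.
Qed.

Lemma density_bound_ge0 F psi L : has_density F psi L -> 0 <= L.
Proof. by case=> _ /(_ 0 (lexx _)) + _; apply: le_trans. Qed.

Lemma eq_density F G psi phi L : has_density F psi L ->
  (forall t, 0 <= t -> F t = G t) -> (forall t, 0 <= t -> psi t = phi t) ->
  has_density G phi L.
Proof.
move=> [mpsi bpsi FE] FG pp; split.
- apply: eq_measurable_fun mpsi => t; rewrite inE/=; exact: pp.
- by move=> t t0; rewrite -pp//; exact: bpsi.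
- move=> t t0; rewrite -!FG// FE//; congr (_ + _); apply: eq_Rintegral => x.
  by rewrite inE /= => /andP[x0 _]; exact: pp.
Qed.

Lemma has_density_cst (c : R) : has_density (cst c) (cst 0) 0.
Proof.
split => [|t _|t _]; first exact: measurable_cst.
  by rewrite /= normr0.
by rewrite /= /Rintegral integral0 addr0.
Qed.

Lemma has_density_int psi L c : measurable_fun Rnneg psi ->
  (forall t, 0 <= t -> `|psi t| <= L) ->
  has_density (fun t => c + \int[mu]_(s in interval0 t) psi s) psi L.
Proof.
move=> mpsi bpsi; split => // t t0; rewrite /= (_ : interval0 0 = [set 0]).
  by rewrite Rintegral_set1 addr0.
by rewrite interval0E set_itv1.
Qed.

Lemma has_densityD F G psi phi L M : has_density F psi L ->
  has_density G phi M ->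
  has_density (fun t => F t + G t) (fun t => psi t + phi t) (L + M).
Proof.
move=> [mpsi bpsi FE] [mphi bphi GE]; split.
- exact: measurable_funD.
- by move=> t t0; apply: (le_trans (ler_normD _ _)); rewrite lerD ?bpsi ?bphi.
- move=> t t0; rewrite FE// GE// addrACA; congr (_ + _).
  rewrite interval0E RintegralD//.
    exact: bounded_integrable mpsi bpsi _.
  exact: bounded_integrable mphi bphi _.
Qed.

Lemma has_densityZ F psi L c : has_density F psi L ->
  has_density (fun t => c * F t) (fun t => c * psi t) (`|c| * L).
Proof.
move=> [mpsi bpsi FE]; split.
- by apply: measurable_funM => //; exact: measurable_cst.
- by move=> t t0; rewrite normrM ler_wpM2l// bpsi.
- move=> t t0; rewrite FE// mulrDr; congr (_ + _).
  rewrite interval0E RintegralZl//.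
  exact: bounded_integrable mpsi bpsi _.
Qed.

Lemma has_densityB F G psi phi L M : has_density F psi L ->
  has_density G phi M ->
  has_density (fun t => F t - G t) (fun t => psi t - phi t) (L + M).
Proof.
move=> dF /(has_densityZ (-1)); rewrite normrN1 mul1r => dG.
by apply: eq_density (has_densityD dF dG) _ _ => t _; rewrite mulN1r.
Qed.

Lemma has_density_sum (I : finType) (F psi : I -> R -> R) (L : I -> R) :
  (forall i, has_density (F i) (psi i) (L i)) ->
  has_density (fun t => \sum_i F i t) (fun t => \sum_i psi i t) (\sum_i L i).
Proof.
move=> dF; elim: (index_enum I) => [|i s IH].
  rewrite big_nil; apply: eq_density (has_density_cst 0) _ _ => t _;
  by rewrite big_nil.
rewrite big_cons; apply: eq_density (has_densityD (dF i) IH) _ _ => t _;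
by rewrite big_cons.
Qed.

(** Past the supremum of the times at which [F] is nonnegative, [F] is negative and therefore cannot
    decrease. Near the supremum, the Lipschitz bound limits the loss to a multiple of an arbitrarily
    small [k]. *)
Lemma lip_nneg (F : R -> R) L a b : a <= b ->
  (forall s t, a <= s -> s <= t -> t <= b -> `|F t - F s| <= L * (t - s)) ->
  0 <= F a ->
  (forall s t, a <= s -> s <= t -> t <= b ->
     (forall u, s <= u <= t -> F u < 0) -> F s <= F t) ->
  0 <= F b.
Proof.
move=> ab lipF Fa incrF.
pose A := [set s | a <= s <= b /\ 0 <= F s].
have Aa : A a by split => //; rewrite lexx.
have supA : has_sup A by split; [exists a|exists b => x [/andP[]]].
have aS : a <= sup A by apply: ub_le_sup => //; case: supA.
have Sb : sup A <= b by apply: sup_le_ub; [exists a|move=> x [/andP[]]].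
suff H k : 0 < k -> - (2 * `|L| * k) <= F b.
  rewrite leNgt; apply/negP => Fb.
  have k0 : 0 < - F b / (2 * `|L| + 1).
    by rewrite divr_gt0 ?oppr_gt0// ltr_wpDl// mulr_ge0.
  have := H _ k0; apply/negP; rewrite -ltNge.
  rewrite ltrNr mulrA ltr_pdivrMr ?ltr_wpDl ?mulr_ge0//.
  rewrite mulrC ltr_pM2l ?oppr_gt0//; lra.
move=> k0; have [s' [/andP[as' s'b] Fs'] Ss'] := sup_adherent k0 supA.
have s'S : s' <= sup A by apply: ub_le_sup; [case: supA|split => //; rewrite as'].
(* This time is at most [2 * k] after [s'], and lies past the supremum unless it is cut off at
   [b]. *)
pose s := Num.min (sup A + k) b.
have sb : s <= b by rewrite /s ge_min lexx orbT.
have s's : s' <= s by rewrite /s le_min s'b andbT (le_trans s'S)// lerDl ltW.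
have sks : s <= s' + 2 * k by rewrite /s ge_min; apply/orP; left; lra.
have Fss : - (2 * `|L| * k) <= F s.
  have /ler_normlP[H _] := lipF s' s as' s's sb.
  have : L * (s - s') <= `|L| * (2 * k).
    apply: (@le_trans _ _ (`|L| * (s - s'))).
      by rewrite ler_wpM2r ?subr_ge0// ler_norm.
    by rewrite ler_wpM2l//; lra.
  move=> H2; have : 2 * `|L| * k = `|L| * (2 * k) by ring.
  by move=> ->; lra.
apply: (le_trans Fss).
have [->//|sneb] := eqVneq s b.
apply: incrF => //; first exact: le_trans s's.
move=> u /andP[su ub]; rewrite ltNge; apply/negP => Fu.
have : u <= sup A.
  apply: ub_le_sup; first by case: supA.
  by split => //; rewrite ub andbT (le_trans as')// (le_trans s's).
move/(le_trans su); rewrite leNgt /s lt_min ltrDl k0/=.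
apply/negP; rewrite negbK lt_neqAle Sb andbT; apply: contra_neq sneb => Sb'.
by rewrite /s Sb'; apply/min_idPr; rewrite lerDl ltW.
Qed.

(* The sign condition on [psi] is only needed where [F < 0], so nothing has to
   be known about the derivative of [F] on its zero set. *)
Lemma density_nneg F psi L a b : has_density F psi L -> 0 <= a -> a <= b ->
  0 <= F a -> (forall u, a <= u <= b -> F u < 0 -> 0 <= psi u) -> 0 <= F b.
Proof.
move=> dF a0 ab Fa H; apply: (@lip_nneg F L a b) => //.
  by move=> s t as' st _; apply: (density_lip dF) => //; exact: le_trans as'.
move=> s t as' st tb Fneg; apply: (density_mono dF) => //.
  exact: le_trans as'.
move=> u /andP[/ltW su ut]; apply: H; last by apply: Fneg; rewrite su ut.
by rewrite (le_trans as')//= (le_trans ut).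
Qed.

(** The constant extension of [F] to negative times is continuous, hence measurable. *)
Lemma lip_measurable (F : R -> R) L :
  (forall s t, 0 <= s -> s <= t -> `|F t - F s| <= L * (t - s)) ->
  measurable_fun Rnneg F.
Proof.
move=> lipF.
have L0 : 0 <= L.
  by have := lipF 0 1 (lexx _) ler01; rewrite subr0 mulr1; apply: le_trans.
apply: (@eq_measurable_fun _ _ _ _ _ (fun t => F (Num.max t 0))).
  by move=> t; rewrite inE/= => t0; rewrite (max_idPl t0).
apply: measurable_funTS; apply: continuous_measurable_fun => x.
have lipG s t : `|F (Num.max s 0) - F (Num.max t 0)| <= L * `|s - t|.
  wlog ts : s t / t <= s.
    move=> H; case: (leP t s) => [/H//|/ltW/H].
    by rewrite distrC [`|t - s|]distrC.
  apply: (@le_trans _ _ (L * (Num.max s 0 - Num.max t 0))).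
    by apply: lipF; [rewrite le_max lexx orbT|rewrite ge_max !le_max ts lexx orbT].
  rewrite ler_wpM2l//; apply: (le_trans _ (ler_norm (s - t))).
  by rewrite /Num.max; case: (ltP s 0) => ?; case: (ltP t 0) => ?; lra.
apply/cvgrPdist_lt => e e0; near=> y.
apply: (le_lt_trans (lipG _ _)).
apply: (@le_lt_trans _ _ ((L + 1) * `|x - y|)).
  by rewrite ler_wpM2r// lerDl.
rewrite mulrC -ltr_pdivlMr; last by rewrite ltr_wpDl.
near: y; apply: (@cvgr_dist_lt _ _ _ (nbhs x) _ id); first exact: cvg_id.
by rewrite divr_gt0// ltr_wpDl.
Unshelve. all: by end_near. Qed.

(** Over [n.+1] equal steps the increments add up to at most [C * t ^+ 2 / n.+1], which is
    arbitrarily small. *)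
Lemma quadratic_const (phi : R -> R) C t : 0 <= t ->
  (forall s u, 0 <= s -> s <= u -> `|phi u - phi s| <= C * (u - s) ^+ 2) ->
  phi t = phi 0.
Proof.
move=> t0 H; apply/eqP; rewrite -subr_eq0 -normr_le0.
suff H1 n : `|phi t - phi 0| <= (C * t ^+ 2) / n.+1%:R.
  rewrite leNgt; apply/negP => p0.
  pose n := Num.truncn (C * t ^+ 2 / `|phi t - phi 0|).
  have := H1 n; rewrite ler_pdivlMr ?ltr0n// mulrC -ler_pdivlMr//.
  by apply/negP; rewrite -ltNge; exact: truncnS_gt.
pose h := t / n.+1%:R.
have h0 : 0 <= h by rewrite divr_ge0.
have H2 k : `|phi (k%:R * h) - phi 0| <= k%:R * (C * h ^+ 2).
  elim: k => [|k IH]; first by rewrite !mul0r subrr normr0.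
  have := H (k%:R * h) (k.+1%:R * h) (mulr_ge0 (ler0n _ _) h0).
  rewrite -natr1 mulrDl mul1r lerDl => /(_ h0).
  rewrite addrAC subrr add0r => H3.
  rewrite [leRHS]mulrDl mul1r [leRHS]addrC.
  by apply: (le_trans (ler_distD (phi (k%:R * h)) _ _)); rewrite lerD.
have := H2 n.+1; have -> : n.+1%:R * h = t by rewrite mulrC divfK// pnatr_eq0.
move/le_trans; apply; rewrite le_eqVlt; apply/orP; left; apply/eqP.
rewrite /h expr_div_n; field; rewrite addrC natr1 pnatr_eq0//.
Qed.

End Antiderivatives.

(** * Reflection at the empty state *)

Section Reflection.
Context {R : realType}.
Local Notation mu := (@lebesgue_measure R).
Local Notation Rnneg := [set t : R | 0 <= t].
Implicit Types (X Y F f e : R -> R) (L s t u x y eps : R).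

(* Skorokhod's regulator at 0: [Y t = sup_(s <= t) (- X s)^+]. *)
Lemma regulator_exists X L : 0 <= L -> 0 <= X 0 ->
  (forall s t, 0 <= s -> s <= t -> `|X t - X s| <= L * (t - s)) ->
  exists Y, [/\ Y 0 = 0,
    forall s t, 0 <= s -> s <= t -> 0 <= Y t - Y s <= L * (t - s),
    forall t, 0 <= t -> 0 <= X t + Y t &
    forall s t, 0 <= s -> s <= t -> Y s < Y t -> X s + Y s <= L * (t - s)].
Proof.
move=> L0 X0 lipX.
(* The element [0] accounts for the positive part and keeps the set nonempty. *)
pose A t := [set y | y = 0 \/ exists s, 0 <= s <= t /\ y = - X s].
have A0 t : A t 0 by left.
have AX s t : 0 <= s -> s <= t -> A t (- X s).
  by move=> s0 st; right; exists s; rewrite s0 st.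
have ubA t : 0 <= t -> has_ubound (A t).
  move=> t0; exists (L * t) => y [->|[s [/andP[s0 st] ->]]].
    exact: mulr_ge0.
  have := lipX 0 s (lexx _) s0; rewrite subr0 => /ler_normlP[H _].
  have : L * s <= L * t by rewrite ler_wpM2l.
  lra.
have supA t : 0 <= t -> has_sup (A t).
  by move=> t0; split; [exists 0|exact: ubA].
have subA s t : s <= t -> A s `<=` A t.
  move=> st y [->|[u [/andP[u0 us] ->]]]; [by left|right; exists u; split => //].
  by rewrite u0 (le_trans us).
exists (fun t => sup (A t)); split.
- apply/eqP; rewrite eq_le; apply/andP; split.
    apply: sup_le_ub; first by exists 0.
    move=> y [->//|[s [/andP[s0 s0'] ->]]].
    have -> : s = 0 by apply/eqP; rewrite eq_le s0 s0'.
    by rewrite oppr_le0.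
  by apply: ub_le_sup => //; exact: ubA.
- move=> s t s0 st; rewrite subr_ge0; apply/andP; split.
    apply: ge_sup; first by exists 0.
    move=> y Ay; apply: ub_le_sup; first exact/ubA/(le_trans s0).
    exact: subA Ay.
  rewrite lerBlDr; apply: sup_le_ub; first by exists 0.
  move=> y [->|[u [/andP[u0 ut] ->]]].
    rewrite addr_ge0// ?mulr_ge0 ?subr_ge0//.
    by apply: ub_le_sup => //; exact: ubA.
  have [us|/ltW su] := leP u s.
    rewrite ler_wpDl ?mulr_ge0 ?subr_ge0//.
    by apply: ub_le_sup; [exact: ubA|exact: AX].
  have := lipX s u s0 su => /ler_normlP[H _].
  have : L * (u - s) <= L * (t - s) by rewrite ler_wpM2l// lerB.
  have : - X s <= sup (A s) by apply: ub_le_sup; [exact: ubA|exact: AX].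
  lra.
- move=> t t0; rewrite -lerBlDl sub0r.
  by apply: ub_le_sup; [exact: ubA|exact: AX].
(* If the supremum grows after [s], some [u] in [[s, t]] has [- X u] above [Y s]; then [X s + Y s]
   is below [X s - X u], which the Lipschitz bound controls. *)
- move=> s t s0 st Yst.
  have t0 := le_trans s0 st.
  have gap : 0 < sup (A t) - sup (A s) by rewrite subr_gt0.
  have [y Ay] := sup_adherent gap (supA t t0).
  rewrite opprB addrC subrK => Ysy.
  have nAs : ~ A s y.
    by move=> /(ub_le_sup (ubA _ s0)); apply/negP; rewrite -ltNge.
  case: Ay => [y0|[u [/andP[u0 ut] yE]]]; first by case: nAs; rewrite y0.
  have su : s <= u.
    by rewrite leNgt; apply/negP => /ltW us; apply: nAs; rewrite yE; exact: AX.
  have := lipX s u s0 su => /ler_normlP[H _].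
  have : L * (u - s) <= L * (t - s) by rewrite ler_wpM2l// lerB.
  by move: Ysy; rewrite yE; lra.
Qed.

(* [eps (1 - q y)] and its derivative [q y ^+ 2], where
   [q y = eps / (eps + y)], approximate [0] and the indicator of [{0}] on
   the nonnegative half-line. *)
Lemma soft_indicator eps x y (q := fun z => eps / (eps + z)) :
  0 < eps -> 0 <= x -> 0 <= y ->
  [/\ 0 < q x <= 1, q x - q y = q x * q y * (y - x) / eps,
      `|eps * (1 - q y) - eps * (1 - q x) - q x ^+ 2 * (y - x)|
        <= (y - x) ^+ 2 / eps &
      `|q x ^+ 2 - q y ^+ 2| <= 2 * `|y - x| / eps].
Proof.
move=> e0 x0 y0.
have ex : 0 < eps + x by rewrite ltr_wpDr.
have ey : 0 < eps + y by rewrite ltr_wpDr.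
have q01 z : 0 <= z -> 0 < q z <= 1.
  move=> z0; have ez : 0 < eps + z by rewrite ltr_wpDr.
  by rewrite /q divr_gt0//= ler_pdivrMr// mul1r lerDl.
have qxy : q x - q y = q x * q y * (y - x) / eps.
  by rewrite /q; field; rewrite !gt_eqF.
clearbody q; have /andP[qx0 qx1] := q01 _ x0; have /andP[qy0 qy1] := q01 _ y0.
have [qx_ge0 qy_ge0] := (ltW qx0, ltW qy0).
have qq1 : q x * q y <= 1 by rewrite mulr_ile1.
split => //; first by rewrite qx0.
  have -> : eps * (1 - q y) - eps * (1 - q x) - q x ^+ 2 * (y - x) =
      - (q x * (q x * q y) * ((y - x) ^+ 2 / eps)).
    have -> : eps * (1 - q y) - eps * (1 - q x) = eps * (q x - q y) by ring.
    have -> : - (q x * (q x * q y) * ((y - x) ^+ 2 / eps)) =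
      - (q x * (y - x) * (q x * q y * (y - x) / eps)) by ring.
    rewrite -qxy (_ : eps * (q x - q y) = q x * q y * (y - x)); first by ring.
    by rewrite qxy; field; rewrite gt_eqF.
  have sq0 : 0 <= (y - x) ^+ 2 / eps by rewrite divr_ge0 ?sqr_ge0 ?(ltW e0).
  have qqq0 : 0 <= q x * (q x * q y) by rewrite !mulr_ge0.
  rewrite normrN normrM (ger0_norm sq0) ger0_norm// ler_piMl//.
  by rewrite mulr_ile1// mulr_ge0.
have -> : q x ^+ 2 - q y ^+ 2 = (q x - q y) * (q x + q y) by ring.
have -> : (q x - q y) * (q x + q y) =
    (q x * q y * (q x + q y)) * ((y - x) / eps) by rewrite qxy; ring.
have qqq0 : 0 <= q x * q y * (q x + q y).
  by rewrite !mulr_ge0// addr_ge0.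
rewrite normrM (ger0_norm qqq0) normrM (gtr0_norm (_ : 0 < eps^-1)) ?invr_gt0//.
rewrite -[leRHS]mulrA ler_wpM2r ?mulr_ge0 ?invr_ge0 ?(ltW e0)//.
have : q x * q y * (q x + q y) <= 1 * (q x + q y).
  by rewrite ler_wpM2r// addr_ge0.
lra.
Qed.

End Reflection.

(** * Density of Skorokhod's regulator *)

Section ReflectionDensity.
Context {R : realType}.
Local Notation mu := (@lebesgue_measure R).
Local Notation Rnneg := [set t : R | 0 <= t].
Implicit Types (X Y F f e : R -> R) (L s t u x y eps : R).

(* Chain rule along [X + Y] for the functions of [soft_indicator]: since [Y]
   moves only where [X + Y] is close to 0, increments over a step of length
   [h] agree up to [O(h ^+ 2)]. *)
Lemma regulator_approx X Y f L eps t : has_density X f L -> 0 <= X 0 ->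
  Y 0 = 0 ->
  (forall s t, 0 <= s -> s <= t -> 0 <= Y t - Y s <= L * (t - s)) ->
  (forall t, 0 <= t -> 0 <= X t + Y t) ->
  (forall s t, 0 <= s -> s <= t -> Y s < Y t -> X s + Y s <= L * (t - s)) ->
  0 < eps -> 0 <= t ->
  measurable_fun Rnneg (fun s => (eps / (eps + (X s + Y s))) ^+ 2 * f s) /\
  `|Y t + \int[mu]_(s in interval0 t)
      ((eps / (eps + (X s + Y s))) ^+ 2 * f s)| <= eps.
Proof.
move=> dX X0 Y0 lipY e_ge0 Yflat eps0 t0.
have L0 := density_bound_ge0 dX.
have [mf bf _] := dX.
pose e s := X s + Y s; pose q z := eps / (eps + z).
have lipe s u : 0 <= s -> s <= u -> `|e u - e s| <= 2 * L * (u - s).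
  move=> s0 su; have := density_lip dX s0 su.
  have := lipY s u s0 su => /andP[H1 H2].
  rewrite /e opprD addrACA => H3; apply: (le_trans (ler_normD _ _)).
  by rewrite (ger0_norm H1); lra.
have q01 s : 0 <= s -> 0 < q (e s) <= 1.
  by move=> s0; have [] := soft_indicator eps0 (e_ge0 _ s0) (e_ge0 _ s0).
have q201 s : 0 <= s -> 0 <= q (e s) ^+ 2 <= 1.
  by move=> /q01/andP[/ltW q0 q1]; rewrite sqr_ge0 expr_le1.
have mq : measurable_fun Rnneg (fun s => q (e s) ^+ 2 * f s).
  apply: measurable_funM => //; apply: measurable_funX.
  apply: (@lip_measurable _ _ (2 * L / eps)) => s u s0 su.
  have u0 := le_trans s0 su.
  have [_ -> _ _] := soft_indicator eps0 (e_ge0 _ u0) (e_ge0 _ s0).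
  have /andP[qu0 qu1] := q01 _ u0; have /andP[qs0 qs1] := q01 _ s0.
  rewrite -/(q _) -/(q _) -/(e _) -/(e _).
  move: (q (e u)) (q (e s)) qu0 qu1 qs0 qs1 => a b a0 a1 b0 b1.
  rewrite !normrM [`|eps^-1|]gtr0_norm ?invr_gt0//.
  rewrite [leRHS]mulrAC ler_wpM2r ?invr_ge0 ?(ltW eps0)// distrC.
  apply: (le_trans _ (lipe _ _ s0 su)); rewrite ler_piMl//.
  by rewrite !gtr0_norm// mulr_ile1 ?(ltW a0) ?(ltW b0).
split => //.
have bq s : 0 <= s -> `|q (e s) ^+ 2 * f s| <= L.
  move=> s0; have /andP[q0 q1] := q201 _ s0; rewrite normrM (ger0_norm q0).
  by apply: (le_trans _ (bf _ s0)); rewrite ler_piMl.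
pose W t := 0 + \int[mu]_(s in interval0 t) (q (e s) ^+ 2 * f s).
have dW : has_density W (fun s => q (e s) ^+ 2 * f s) L.
  exact: has_density_int.
(* Formally [phi] has differential [(q (e t) ^+ 2 - 1) dY], which vanishes in the limit of small
   steps because [Y] moves only where [q (e t)] is close to 1. *)
pose phi t := eps * (1 - q (e t)) - Y t - W t.
have phi_quad s u : 0 <= s -> s <= u ->
    `|phi u - phi s| <= (10 * L ^+ 2 / eps) * (u - s) ^+ 2.
  move=> s0 su; have u0 := le_trans s0 su.
  have us : 0 <= u - s by rewrite subr_ge0.
  (* Three errors: the Taylor remainder of [eps * (1 - q)], the variation of [q ^+ 2] along the step
     integrated against [f], and the regulator term. They contribute the constants 4, 4 and 2. *)
  have -> : phi u - phi s =
      (eps * (1 - q (e u)) - eps * (1 - q (e s)) - q (e s) ^+ 2 * (e u - e s)) +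
      ((q (e s) ^+ 2 * X u - W u) - (q (e s) ^+ 2 * X s - W s)) +
      (q (e s) ^+ 2 - 1) * (Y u - Y s).
    by rewrite /phi /e; ring.
  have -> : 10 * L ^+ 2 / eps * (u - s) ^+ 2 =
      4 * L ^+ 2 * (u - s) ^+ 2 / eps + 4 * L ^+ 2 * (u - s) ^+ 2 / eps +
      2 * L ^+ 2 * (u - s) ^+ 2 / eps by ring.
  apply: (le_trans (ler_normD _ _)); apply: lerD.
  apply: (le_trans (ler_normD _ _)); apply: lerD.
  - have [_ _ + _] := soft_indicator eps0 (e_ge0 _ s0) (e_ge0 _ u0).
    move/le_trans; apply; rewrite ler_wpM2r ?invr_ge0 ?(ltW eps0)//.
    rewrite -/(e _) -/(e _) -real_normK ?num_real//.
    have -> : 4 * L ^+ 2 * (u - s) ^+ 2 = (2 * L * (u - s)) ^+ 2 by ring.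
    by rewrite lerXn2r ?nnegrE ?normr_ge0 ?mulr_ge0//; exact: lipe.
  - have dZ := has_densityB (has_densityZ (q (e s) ^+ 2) dX) dW.
    pose B := 4 * L ^+ 2 * (u - s) / eps.
    have -> : 4 * L ^+ 2 * (u - s) ^+ 2 / eps = B * (u - s) by rewrite /B; ring.
    rewrite ler_norml -mulNr.
    apply: (density_incr_bounds dZ) => // v /andP[/ltW sv vu].
    have v0 := le_trans s0 sv.
    rewrite -ler_norml -mulrBl normrM.
    have [_ _ _ H] := soft_indicator eps0 (e_ge0 _ s0) (e_ge0 _ v0).
    have -> : B = (2 * (2 * L * (u - s)) / eps) * L by rewrite /B; ring.
    apply: ler_pM => //; last exact: bf.
    apply: (le_trans H); rewrite ler_wpM2r ?invr_ge0 ?(ltW eps0)// ler_wpM2l//.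
    apply: (le_trans (lipe _ _ s0 sv)); rewrite ler_wpM2l ?mulr_ge0//.
    by rewrite lerB.
  - have /andP[Yus0 YusL] := lipY _ _ s0 su.
    have [Yus|Yus] := leP (Y u) (Y s).
      have -> : Y u - Y s = 0.
        by apply/eqP; rewrite eq_le Yus0 andbT subr_le0.
      rewrite mulr0 normr0 !mulr_ge0 ?sqr_ge0// invr_ge0 ltW//.
    have es := Yflat _ _ s0 su Yus.
    have [_ _ _ H] := soft_indicator eps0 (lexx 0) (e_ge0 _ s0).
    have -> : 2 * L ^+ 2 * (u - s) ^+ 2 / eps =
       (2 * (L * (u - s)) / eps) * (L * (u - s)) by ring.
    rewrite normrM (ger0_norm Yus0); apply: ler_pM => //.
    move: H; rewrite addr0 divff ?gt_eqF// expr1n subr0 distrC.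
    move/le_trans; apply; rewrite ler_wpM2r ?invr_ge0 ?(ltW eps0)// ler_wpM2l//.
    by rewrite ger0_norm ?e_ge0.
(* As [phi] is constant, [Y t] plus the integral is a difference of two values of [eps * (1 - q)],
   both between [0] and [eps]. *)
have := quadratic_const t0 phi_quad; rewrite /phi.
have W0 : W 0 = 0.
  rewrite /W add0r (_ : interval0 0 = [set 0]) ?Rintegral_set1//.
  by rewrite interval0E set_itv1.
rewrite W0 Y0 !subr0 {1}/W add0r -/(e _).
set I := (\int[mu]_(_ in _) _) => H.
have -> : Y t + I = eps * (1 - q (e t)) - eps * (1 - q (e 0)) by lra.
have /andP[qt0 qt1] := q01 _ t0; have /andP[q00 q01'] := q01 _ (lexx 0).
have K z : 0 < z -> z <= 1 -> 0 <= eps * (1 - z) <= eps.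
  move=> z0 z1; rewrite mulr_ge0 ?subr_ge0//= ?(ltW eps0)//.
  by rewrite ler_piMr ?(ltW eps0)// lerBlDr lerDl ltW.
have := K _ qt0 qt1; have := K _ q00 q01'.
rewrite ler_norml; lra.
Qed.

Lemma soft_indicator_cvg y : 0 <= y ->
  ((n.+1%:R^-1 / (n.+1%:R^-1 + y)) ^+ 2 @[n --> \oo] -->
     ((y <= 0)%R%:R : R)).
Proof.
move=> y0; have [yle|ylt] := leP y 0.
  have -> : y = 0 by apply/eqP; rewrite eq_le yle.
  rewrite (_ : (fun _ => _) = cst 1); first exact: cvg_cst.
  apply/funext => n; rewrite addr0 divff ?expr1n// invr_eq0 pnatr_eq0//.
have h0 : n.+1%:R^-1 @[n --> \oo] --> (0 : R) by exact: cvg_harmonic.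
apply: (@squeeze_cvgr _ _ _ _ (cst 0) (fun n => n.+1%:R^-1 / y)).
- apply: nearW => n; rewrite /= sqr_ge0/=.
  set h : R := n.+1%:R^-1.
  have hgt0 : 0 < h by rewrite invr_gt0.
  have H : h / (h + y) <= 1.
    by rewrite ler_pdivrMr ?mul1r ?lerDl ?ltW// addr_gt0.
  have H0 : 0 <= h / (h + y) by rewrite divr_ge0 ?addr_ge0// ltW.
  rewrite expr2 (le_trans (ler_piMl H0 H))// ler_pM2l//.
  by rewrite lef_pV2 ?posrE ?addr_gt0// lerDr ltW.
- exact: cvg_cst.
- have -> : (false%:R : R) = 0 * y^-1 by rewrite mul0r.
  exact: cvgMl.
Qed.

(** Dominated convergence in [regulator_approx] along [eps = n.+1%:R^-1]: the integrands are bounded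
    by [L], and the squared quotient tends to the indicator of the zero set of [X + Y]. *)
Lemma regulator_density X Y f L t : has_density X f L -> 0 <= X 0 ->
  Y 0 = 0 ->
  (forall s t, 0 <= s -> s <= t -> 0 <= Y t - Y s <= L * (t - s)) ->
  (forall t, 0 <= t -> 0 <= X t + Y t) ->
  (forall s t, 0 <= s -> s <= t -> Y s < Y t -> X s + Y s <= L * (t - s)) ->
  0 <= t ->
  measurable_fun Rnneg (fun s => (X s + Y s <= 0)%R%:R * f s) /\
  Y t = - \int[mu]_(s in interval0 t) ((X s + Y s <= 0)%R%:R * f s).
Proof.
move=> dX X0 Y0 lipY e_ge0 Yflat t0.
have L0 := density_bound_ge0 dX.
have [mf bf _] := dX.
have approx n := @regulator_approx X Y f L n.+1%:R^-1 t dX X0 Y0 lipY e_ge0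
  Yflat ltac:(by rewrite invr_gt0) t0.
pose g n s := (n.+1%:R^-1 / (n.+1%:R^-1 + (X s + Y s))) ^+ 2 * f s.
have gcvg s : 0 <= s -> g n s @[n --> \oo] --> (X s + Y s <= 0)%R%:R * f s.
  by move=> s0; apply: cvgMl; apply: soft_indicator_cvg; exact: e_ge0.
have mlim : measurable_fun Rnneg (fun s => (X s + Y s <= 0)%R%:R * f s).
  apply: (@measurable_fun_cvg _ _ _ _ g) => // n; exact: (approx n).1.
split => //.
have sub0 : interval0 t `<=` Rnneg by move=> s /andP[].
have mI : measurable (interval0 t) by rewrite interval0E; exact: measurable_itv.
have mS (h : R -> R) : measurable_fun Rnneg h ->
    measurable_fun (interval0 t) (EFin \o h).
  move=> mh; apply/measurable_EFinP.
  by apply: measurable_funS mh => //; exact: measurable_nneg.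
have intL : mu.-integrable (interval0 t) (EFin \o cst L).
  by rewrite interval0E; exact: cst_integrable.
have bg s n : 0 <= s -> `|g n s| <= L.
  move=> s0; have n0 : 0 < n.+1%:R^-1 :> R by rewrite invr_gt0.
  have [/andP[q0 q1] _ _ _] := soft_indicator n0 (e_ge0 _ s0) (e_ge0 _ s0).
  rewrite /g normrM -[leRHS]mul1r ler_pM// ?bf//.
  by rewrite ger0_norm ?sqr_ge0// expr_le1// ltW.
have gcvgE : {ae mu, forall s, interval0 t s ->
    (g n s)%:E @[n --> \oo] --> ((X s + Y s <= 0)%R%:R * f s)%:E}.
  apply: aeW => s st; apply: cvg_EFin; first by apply: nearW.
  exact: (gcvg s (sub0 _ st)).
have bgE : {ae mu, forall s n, interval0 t s ->
    (`|(g n s)%:E| <= (EFin \o cst L) s)%E}.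
  by apply: aeW => s n st; rewrite lee_fin; exact: (bg s n (sub0 _ st)).
have [intf _ icvg] := @dominated_convergence _ _ _ mu _ mI
  (fun n s => (g n s)%:E) (fun s => ((X s + Y s <= 0)%R%:R * f s)%:E) _
  (fun n => mS _ (approx n).1) (mS _ mlim) gcvgE intL bgE.
have icvgR : \int[mu]_(s in interval0 t) g n s @[n --> \oo] -->
    \int[mu]_(s in interval0 t) ((X s + Y s <= 0)%R%:R * f s).
  apply: fine_cvg; rewrite fineK//; exact: integrable_fin_num.
apply/eqP; rewrite -addr_eq0 -normr_eq0; apply/eqP.
have : `|Y t + \int[mu]_(s in interval0 t) g n s| @[n --> \oo] --> (0 : R).
  apply: (@squeeze_cvgr _ _ _ _ (cst 0) (fun n => n.+1%:R^-1)).
  - by apply: nearW => n; rewrite normr_ge0/=; exact: (approx n).2.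
  - exact: cvg_cst.
  - exact: cvg_harmonic.
move=> H; apply: (@cvg_unique _ (@Rhausdorff R) _ _ _ _ _ H).
by apply: cvg_norm; apply: cvgD => //; exact: cvg_cst.
Qed.

End ReflectionDensity.

(** * The solution blocked at empty only *)

Section OneSidedReflection.
Context {R : realType}.
Local Notation mu := (@lebesgue_measure R).
Local Notation Rnneg := [set t : R | 0 <= t].
Implicit Types (X Y F f e : R -> R) (L s t u x y : R).

Lemma derive1_gt0_left F x (d : R) : derivable F x 1 -> 0 < F^`()%classic x -> 0 < d ->
  exists h, 0 < h <= d /\ F (x - h) < F x.
Proof.
move=> dF; rewrite derive1E => F'x d0.
have /cvgr_gt/(_ _ F'x) : (fun h => h^-1 *: (F (h *: 1 + x) - F x)) @ 0^' -->
  'D_1 F x by exact: dF.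
rewrite near_withinE => /nbhs_ballP[r /= r0 H].
exists (Num.min d (r / 2)); have h0 : 0 < Num.min d (r / 2).
  by rewrite lt_min d0 divr_gt0.
have hr : Num.min d (r / 2) < r by rewrite gt_min; apply/orP; right; lra.
rewrite h0 ge_min lexx; split => //.
move: (Num.min _ _) h0 hr => h h0 hr.
have := H (- h); rewrite /ball/= sub0r opprK gtr0_norm// oppr_eq0 gt_eqF//.
move=> /(_ hr isT); rewrite invrN scaleNr oppr_gt0 pmulr_rlt0 ?invr_gt0//.
by rewrite subr_lt0 [_ *: _]mulr1 addrC.
Qed.

(** By Lebesgue differentiation [X] has derivative [f] almost everywhere, and a positive derivative
    at [x] forces smaller values just to the left. Extending [f] by zero makes it locally integrable
    on the whole line. *)
Lemma density_gt0_left X f L : has_density X f L ->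
  {ae mu, forall x, 0 < x -> 0 < f x -> exists s, 0 <= s <= x /\ X s < X x}.
Proof.
move=> dX; have L0 := density_bound_ge0 dX; have [mf bf XE] := dX.
pose f0 := f \_ Rnneg.
have mf0 : measurable_fun setT f0.
  exact/(measurable_restrictT _ measurable_nneg).
have bf0 x : `|f0 x| <= L.
  rewrite /f0 patchE; case: ifPn => [|_]; last by rewrite normr0.
  by rewrite inE; exact: bf.
have intf0 y : mu.-integrable [set` Interval (BLeft 0) (BRight y)] (EFin \o f0).
  apply: (@bounded_integrable _ _ L) => //.
    exact: measurable_funTS.
have locf0 : locally_integrable setT f0.
  split => //; first exact: openT.
  move=> K _ cK; have mK : measurable K by exact: compact_measurable.
  apply: (@le_lt_trans _ _ (\int[mu]_(x in K) (cst L%:E) x)%E).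
    apply: ge0_le_integral => //.
    - apply/measurable_EFinP; apply: measurableT_comp => //.
      exact: measurable_funTS.
    - by move=> x _; rewrite lee_fin; exact: bf0.
  rewrite integral_cst// lte_mul_pinfty ?lee_fin//.
  exact: compact_finite_measure.
have := FTC1 intf0 locf0; apply: filterS; first exact: (ae_filter_ringOfSetsType mu).
move=> x H x0 fx.
have [|dF F'] := H; first by rewrite lte_fin.
have XF s : 0 <= s -> X s = X 0 + \int[mu]_(t in `[0, s]) f0 t.
  move=> s0; rewrite XE// interval0E; congr (_ + _).
  apply: eq_Rintegral => t; rewrite inE/= in_itv/= => /andP[t0 _].
  by rewrite /f0 patchE mem_set.
have [|h [/andP[h0 hx] Fh]] := derive1_gt0_left dF _ x0.
  by rewrite F' /f0 patchE mem_set//= ltW.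
exists (x - h); rewrite subr_ge0 hx lerBlDr lerDl ltW//; split => //.
by rewrite (XF x) ?ltW// (XF (x - h)) ?subr_ge0// ltrD2l.
Qed.

(** For [e = X + Y], the regulator cancels [f] on the whole zero set of [e], while the rate required
    here cancels only negative input. The two rates differ only where [e] is zero and [f] is
    positive, which is shown to be a null set. *)
Lemma reflection_exists f L x : measurable_fun Rnneg f ->
  (forall t, 0 <= t -> `|f t| <= L) -> 0 <= x ->
  exists e, [/\ e 0 = x, forall t, 0 <= t -> 0 <= e t &
    has_density e (fun t => if (e t <= 0) && (f t < 0) then 0 else f t) L].
Proof.
move=> mf bf x0.
pose X t := x + \int[mu]_(s in interval0 t) f s.
have dX : has_density X f L by exact: has_density_int.
have L0 := density_bound_ge0 dX.
have X0 : X 0 = x.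
  rewrite /X (_ : interval0 0 = [set 0]) ?Rintegral_set1 ?addr0//.
  by rewrite interval0E set_itv1.
have X0_ge0 : 0 <= X 0 by rewrite X0.
have [Y [Y0 lipY e_ge0 Yflat]] :=
  regulator_exists L0 X0_ge0 (fun s t => density_lip dX (s := s) (t := t)).
pose e t := X t + Y t.
have RD t := regulator_density dX X0_ge0 Y0 lipY e_ge0 Yflat (t := t).
have mK := (RD 0 (lexx _)).1.
exists e; split => //; first by rewrite /e Y0 addr0.
pose q t := if (e t <= 0) && (f t < 0) then 0 else f t.
have bq t : 0 <= t -> `|q t| <= L.
  by move=> t0; rewrite /q; case: ifP => _; [rewrite normr0|exact: bf].
have me : measurable_fun Rnneg e.
  apply: (@lip_measurable _ _ (2 * L)) => s t s0 st.
  have := density_lip dX s0 st; have /andP[H1 H2] := lipY s t s0 st.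
  have -> : e t - e s = (X t - X s) + (Y t - Y s) by rewrite /e; ring.
  move=> H3; apply: (le_trans (ler_normD _ _)).
  by rewrite (ger0_norm H1); lra.
have mq : measurable_fun Rnneg q.
  apply: measurable_fun_if => //; first exact: measurable_nneg.
  - apply: measurable_and.
      by apply: measurable_fun_ler => //; exact: measurable_cst.
    by apply: measurable_fun_ltr => //; exact: measurable_cst.
  - by apply: measurable_funS mf => //; exact: measurable_nneg.
split => // t t0; rewrite {1}/e (RD t t0).2 /X.
have sub0 : interval0 t `<=` Rnneg by move=> s /andP[].
have mI : measurable (interval0 t) by rewrite interval0E; exact: measurable_itv.
have bK s : 0 <= s -> `|(X s + Y s <= 0)%R%:R * f s| <= L.
  by move=> s0; case: (_ <= 0); rewrite ?mul1r ?mul0r ?normr0//; exact: bf.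
rewrite -addrA -RintegralB//; last 2 first.
- by rewrite interval0E; exact: bounded_integrable mf bf _.
- by rewrite interval0E; exact: bounded_integrable mK bK _.
rewrite /e Y0 addr0 X0; congr (_ + _); congr fine.
have mS (h : R -> R) : measurable_fun Rnneg h ->
    measurable_fun (interval0 t) (EFin \o h).
  move=> mh; apply/measurable_EFinP.
  by apply: measurable_funS mh => //; exact: measurable_nneg.
apply: ae_eq_integral => //.
- by apply: (mS (fun x => f x - (X x + Y x <= 0)%R%:R * f x)); exact: measurable_funB.
- exact: (mS q).
(* where [f > 0] and [e = 0], [e] would have been negative just before *)
have := density_gt0_left dX.
have : {ae mu, forall s, s != 0}.
  exists [set 0]; split => //; first exact: lebesgue_measure_set1.
  by move=> s /= /negP; rewrite negbK => /eqP.
apply: filterS2; first exact: (ae_filter_ringOfSetsType mu).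
move=> s sneq0 H st; rewrite -/(e s); congr EFin.
have s0 : 0 <= s by exact: sub0.
have [es|es] := leP (e s) 0 => /=; last by rewrite mul0r subr0.
rewrite mul1r subrr; case: ltgtP => // fs.
have [|u [/andP[u0 us] Xus]] := H _ fs; first by rewrite lt_neqAle eq_sym sneq0.
have := e_ge0 u u0; have := lipY u s u0 us => /andP[+ _].
by move: es; rewrite /e; lra.
Qed.

End OneSidedReflection.

(** * Blocking at the empty and full states *)

Section TwoSidedReflection.
Context {R : realType}.
Local Notation Rnneg := [set t : R | 0 <= t].
Implicit Types (F f e psi : R -> R) (L M s t u v x y b c d : R).

(** Blocking also acts outside [[0, b]], which makes the rate nonincreasing in [y] on the whole
    line; the comparison of solutions then requires no prior bounds on the state. *)
Definition blocked_rate b y v : R :=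
  if ((y <= 0) && (v < 0)) || ((b <= y) && (0 < v)) then 0 else v.

Lemma blocked_rate0 b y : blocked_rate b y 0 = 0.
Proof. by rewrite /blocked_rate; case: ifP. Qed.

Lemma blocked_rate_norm b y v : `|blocked_rate b y v| <= `|v|.
Proof. by rewrite /blocked_rate; case: ifP => _ //; rewrite normr0. Qed.

Lemma blocked_rate_le b y1 y2 v : y2 < y1 ->
  blocked_rate b y1 v <= blocked_rate b y2 v.
Proof.
rewrite /blocked_rate => y21.
by do 2 (case: ifPn => [/orP[]/andP[]|/norP[/nandP[]+/nandP[]]]);
  rewrite -?leNgt -?ltNge => *; lra.
Qed.

(** The mirror symmetry exchanging the empty and the full state. *)
Lemma blocked_rateN b y v : blocked_rate b (b - y) (- v) = - blocked_rate b y v.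
Proof.
rewrite /blocked_rate oppr_lt0 oppr_gt0 subr_le0 lerBrDl -lerBrDr subrr orbC.
by case: ifP => _ //; rewrite oppr0.
Qed.

Lemma has_density_bound F psi L M : has_density F psi L ->
  (forall t, 0 <= t -> `|psi t| <= M) -> has_density F psi M.
Proof. by move=> [mpsi _ FE] bM; split. Qed.

(** By [blocked_rate_le] the lower of two solutions rises at least as fast as the higher one, so
    neither can fall below the other. Agreement of the inputs up to [t] only is what later yields
    non-anticipation and the gluing of solutions. *)
Lemma blocked_solution_unique b e1 e2 f1 f2 L1 L2 t :
  has_density e1 (fun s => blocked_rate b (e1 s) (f1 s)) L1 ->
  has_density e2 (fun s => blocked_rate b (e2 s) (f2 s)) L2 ->
  e1 0 = e2 0 -> (forall s, 0 <= s <= t -> f1 s = f2 s) -> 0 <= t ->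
  e1 t = e2 t.
Proof.
suff H e e' f f' L L' : has_density e (fun s => blocked_rate b (e s) (f s)) L ->
    has_density e' (fun s => blocked_rate b (e' s) (f' s)) L' ->
    e 0 = e' 0 -> (forall s, 0 <= s <= t -> f s = f' s) -> 0 <= t -> e t <= e' t.
  move=> d1 d2 e0 f12 t0; apply/eqP; rewrite eq_le (H _ _ _ _ _ _ d1 d2)//=.
  by rewrite (H _ _ _ _ _ _ d2 d1)// => s /f12.
move=> d1 d2 e0 f12 t0; rewrite -subr_ge0.
apply: (density_nneg (has_densityB d2 d1) (lexx _) t0); first by rewrite e0 subrr.
by move=> s st; rewrite subr_lt0 subr_ge0 f12// => /blocked_rate_le.
Qed.

Lemma density_cst_on F psi L s t : has_density F psi L -> 0 <= s -> s <= t ->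
  (forall u, s < u <= t -> psi u = 0) -> F t = F s.
Proof.
move=> dF s0 st psi0.
have := density_incr_bounds (a := 0) (b := 0) dF s0 st.
rewrite !mul0r -eq_le => H; apply/eqP; rewrite -subr_eq0 eq_sym; apply: H.
by move=> u /psi0 ->; rewrite lexx.
Qed.

Lemma density_pulse F psi L c d t : has_density F psi L -> 0 <= c -> 0 <= d ->
  (forall u, ~~ (c < u <= c + d) -> psi u = 0) -> 0 <= t ->
  [/\ t <= c -> F t = F 0, c + d <= t -> F t = F (c + d) &
      `|F t - F 0| <= L * d].
Proof.
move=> dF c0 d0 psi0 t0.
have Fc u : 0 <= u -> u <= c -> F u = F 0.
  move=> u0 uc; apply: (density_cst_on dF) => // v /andP[_ vu]; apply: psi0.
  by rewrite ltNge (le_trans vu uc).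
have Fcd u : c + d <= u -> F u = F (c + d).
  move=> cdu; apply: (density_cst_on dF) => //; first exact: addr_ge0.
  by move=> v /andP[cdv _]; apply: psi0; rewrite negb_and -!ltNge -leNgt cdv orbT.
have L0 := density_bound_ge0 dF.
have Fmid u : c <= u -> u <= c + d -> `|F u - F 0| <= L * d.
  move=> cu ucd; rewrite -(Fc c)//; apply: (le_trans (density_lip dF c0 cu)).
  by rewrite ler_wpM2l// lerBlDl.
split; [exact: Fc|exact: Fcd|].
have [/(Fc _ t0) ->|/ltW ct] := leP t c.
  by rewrite subrr normr0 mulr_ge0.
have [|/ltW/Fcd ->] := leP t (c + d); first exact: Fmid.
by apply: Fmid; rewrite ?lerDl.
Qed.

(** During the pulse the state moves by less than [b / 2]. Started in the lower half it never gets
    full, so the solution blocked at empty also solves the two-sided problem; the upper half follows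
    by the mirror symmetry. *)
Lemma blocked_solution_pulse b f L x c d : 0 < b -> 0 <= x <= b -> 0 <= c ->
  0 <= d -> L * d < b / 2 -> measurable_fun Rnneg f ->
  (forall t, 0 <= t -> `|f t| <= L) ->
  (forall t, ~~ (c < t <= c + d) -> f t = 0) ->
  exists e, [/\ e 0 = x, forall t, 0 <= t -> 0 <= e t <= b &
    has_density e (fun t => blocked_rate b (e t) (f t)) L].
Proof.
move=> b0 xb c0 d0 Ld.
wlog xb2 : x f xb / x <= b / 2.
  move=> H mf bf fcd; have [|/ltW xb2] := leP x (b / 2).
    by move=> xb2; apply: H.
  have xb' : 0 <= b - x <= b by lra.
  have xb2' : b - x <= b / 2 by lra.
  have bN t : 0 <= t -> `|- f t| <= L by rewrite normrN; exact: bf.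
  have zN t : ~~ (c < t <= c + d) -> - f t = 0 by move=> /fcd ->; rewrite oppr0.
  have [e [e0 eb de]] := H _ _ xb' xb2' (measurable_funN mf) bN zN.
  exists (fun t => b - e t); split.
  - by rewrite e0; ring.
  - by move=> t /eb; lra.
  - have := has_densityB (has_density_cst b) de; rewrite add0r => dbe.
    apply: eq_density dbe _ _ => // t _.
    by rewrite -[in RHS](opprK (f t)) blocked_rateN sub0r.
move=> mf bf fcd.
have /andP[x0 _] := xb.
have [e [e0 e_ge0 de]] := reflection_exists mf bf x0.
have eb t : 0 <= t -> e t < b.
  move=> t0.
  have [|_ _] := density_pulse de c0 d0 _ t0.
    by move=> u /fcd ->; rewrite ltxx andbF.
  by rewrite e0 ler_norml => /andP[_]; lra.
exists e; split => //.
- by move=> t t0; rewrite e_ge0// ltW// eb.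
- apply: eq_density de _ _ => // t t0.
  by rewrite /blocked_rate (leNgt b) eb// orbF.
Qed.

(** A single point has measure zero. This serves the base case of the next induction, where the
    cut-off [t <= 0] still lets the input through at time [0]. *)
Lemma eq_density_gt0 F psi phi L : has_density F psi L ->
  (forall t, 0 < t -> psi t = phi t) -> `|phi 0| <= L -> has_density F phi L.
Proof.
move=> [mpsi bpsi FE] pp phi0.
have mphi : measurable_fun Rnneg phi.
  apply: (@eq_measurable_fun _ _ _ _ _ (fun t => if t <= 0 then phi 0 else psi t)).
    move=> t; rewrite inE/= => t0; case: leP => [tle|/pp//].
    by congr phi; apply/eqP; rewrite eq_le t0 tle.
  apply: measurable_fun_if.
  - exact: measurable_nneg.
  - by apply: measurable_fun_ler => //; exact: measurable_cst.
  - exact: measurable_cst.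
  - by apply: measurable_funS mpsi => //; exact: measurable_nneg.
have bphi t : 0 <= t -> `|phi t| <= L.
  by rewrite le_eqVlt => /predU1P[<-//|t0]; rewrite -pp// bpsi// ltW.
split => // t t0; rewrite FE//; congr (_ + _); rewrite interval0E.
have mu0 (h : R -> R) : measurable_fun Rnneg h -> (forall t, 0 <= t -> `|h t| <= L) ->
    \int[lebesgue_measure]_(s in `[0, t]) h s =
    \int[lebesgue_measure]_(s in `]0, t]) h s.
  by move=> mh bh; rewrite Rintegral_itv_obnd_cbnd//; exact: bounded_integrable bh _.
rewrite !mu0//; apply: eq_Rintegral => s; rewrite inE/= in_itv/= => /andP[s0 _].
exact: pp.
Qed.

(** Induction on the number of time steps: a pulse solution on the next step is started from the
    state reached so far. *)
Lemma blocked_solution_upto b f L x d n : 0 < b -> 0 <= x <= b ->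
  0 <= d -> L * d < b / 2 -> measurable_fun Rnneg f ->
  (forall t, 0 <= t -> `|f t| <= L) ->
  exists e, [/\ e 0 = x, forall t, 0 <= t -> 0 <= e t <= b,
    forall t, n%:R * d <= t -> e t = e (n%:R * d) &
    has_density e (fun t => blocked_rate b (e t)
      (if t <= n%:R * d then f t else 0)) L].
Proof.
move=> b0 xb d0 Ld mf bf; have L0 : 0 <= L := le_trans (normr_ge0 _) (bf 0 (lexx _)).
have mcut y z : measurable_fun Rnneg (fun t => if y < t <= z then f t else 0).
  apply: measurable_fun_if.
  - exact: measurable_nneg.
  - apply: measurable_and.
      by apply: measurable_fun_ltr => //; exact: measurable_cst.
    by apply: measurable_fun_ler => //; exact: measurable_cst.
  - by apply: measurable_funS mf => //; exact: measurable_nneg.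
  - exact: measurable_cst.
have bcut (P : bool) t : 0 <= t -> `|if P then f t else 0| <= L.
  by case: P => t0; [exact: bf|rewrite normr0].
elim: n => [|n [e [e0 eb en de]]].
  exists (cst x); split => //; apply: eq_density_gt0.
  - by apply: (has_density_bound (has_density_cst x)) => t _; rewrite normr0.
  - by move=> t t0; rewrite mul0r leNgt t0 blocked_rate0.
  - exact: le_trans (blocked_rate_norm _ _ _) (bcut _ _ (lexx _)).
have nd0 : 0 <= n%:R * d by rewrite mulr_ge0.
pose xn := e (n%:R * d).
have [F [F0 Fb dF]] := blocked_solution_pulse b0 (eb _ nd0) nd0 d0 Ld
  (mcut _ _) (fun t => bcut _ t) (fun t h => ifN _ _ h).
have Fpulse t : 0 <= t -> [/\ t <= n%:R * d -> F t = xn &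
    n%:R * d + d <= t -> F t = F (n%:R * d + d)].
  move=> t0; have [|+ + _] := density_pulse dF nd0 d0 _ t0; last by rewrite F0.
  by move=> u /negbTE ->; rewrite blocked_rate0.
have Sn : n.+1%:R * d = n%:R * d + d by rewrite -natr1 mulrDl mul1r.
(* Before [n%:R * d] the pulse solution [F] rests at [xn], and afterwards [e] does, so the sum
   follows [e] first and [F] next, and densities simply add. *)
pose H t := e t + F t - xn.
have HE t : 0 <= t -> H t = if t <= n%:R * d then e t else F t.
  move=> t0; rewrite /H; case: leP => [tn|/ltW nt].
    by rewrite (Fpulse _ t0).1// addrK.
  by rewrite en// addrAC subrr add0r.
exists H; split.
- by rewrite HE// nd0.
- by move=> t t0; rewrite HE//; case: ifP => _; [exact: eb|exact: Fb].
- move=> t; rewrite Sn => nt.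
  have ndd : 0 <= n%:R * d + d by exact: addr_ge0.
  have t0 := le_trans ndd nt.
  rewrite /H (Fpulse _ t0).2// !en// ?lerDl//.
  by apply: le_trans nt; rewrite lerDl.
have dH : has_density H (fun t => blocked_rate b (e t)
      (if t <= n%:R * d then f t else 0) +
    blocked_rate b (F t) (if n%:R * d < t <= n%:R * d + d then f t else 0)) (L + L + 0).
  apply: eq_density (has_densityB (has_densityD de dF) (has_density_cst xn)) _ _ => // t _ /=.
  by rewrite subr0.
apply: has_density_bound.
  apply: eq_density dH _ _ => // t t0; rewrite Sn HE//.
  case: leP => [tn|nt] /=; last by rewrite blocked_rate0 add0r.
  by rewrite blocked_rate0 addr0 ler_wpDr.
by move=> t t0; apply: le_trans (blocked_rate_norm _ _ _) (bcut _ _ t0).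
Qed.

(** By uniqueness the solutions with input cut off at multiples of [d] agree as far as their inputs
    do, so they glue to one solution for all time. *)
Lemma blocked_solution_exists b f L x : 0 < b -> 0 <= x <= b ->
  measurable_fun Rnneg f -> (forall t, 0 <= t -> `|f t| <= L) ->
  exists e, e 0 = x /\ has_density e (fun t => blocked_rate b (e t) (f t)) L.
Proof.
move=> b0 xb mf bf; have L0 : 0 <= L := le_trans (normr_ge0 _) (bf 0 (lexx _)).
(* Small enough for [L * d < b / 2]; [L + 1] avoids a division by zero. *)
pose d := b / (4 * (L + 1)).
have L1 : 0 < L + 1 by rewrite ltr_wpDl.
have d0 : 0 < d by rewrite divr_gt0// mulr_gt0.
have Ld : L * d < b / 2.
  have : (L + 1) * d = b / 4 by rewrite /d; field; rewrite gt_eqF.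
  by rewrite mulrDl mul1r; lra.
have [H HP] := choice (fun n => blocked_solution_upto n b0 xb (ltW d0) Ld mf bf).
pose N t := (Num.truncn (t / d)).+1.
have tN t : t <= (N t)%:R * d.
  by rewrite -ler_pdivrMr// ltW// truncnS_gt.
pose e t := H (N t) t.
have eH n t : 0 <= t -> t <= n%:R * d -> e t = H n t.
  move=> t0 tn; have [HN0 _ _ dHN] := HP (N t); have [Hn0 _ _ dHn] := HP n.
  apply: (blocked_solution_unique dHN dHn) => //; first by rewrite HN0 Hn0.
  by move=> s /andP[s0 st]; rewrite (le_trans st tn) (le_trans st (tN t)).
have pH n t : 0 <= t -> t <= n%:R * d ->
    blocked_rate b (H n t) (if t <= n%:R * d then f t else 0) =
    blocked_rate b (e t) (f t).
  by move=> t0 tn; rewrite (eH n)// tn.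
exists e; split; first by rewrite (eH 0)// ?mul0r//; have [] := HP 0.
split.
- have -> : Rnneg = \bigcup_n interval0 (n%:R * d).
    apply/seteqP; split => [t t0|t [n _ /andP[]//]].
    by exists (N t) => //; rewrite /interval0/= t0 tN.
  apply/measurable_fun_bigcup => n.
    by rewrite interval0E; exact: measurable_itv.
  have [_ _ _ [mHn _ _]] := HP n.
  apply: (eq_measurable_fun (fun t => blocked_rate b (H n t)
    (if t <= n%:R * d then f t else 0))).
    by move=> t; rewrite inE => /andP[t0 tn]; exact: pH.
  apply: measurable_funS mHn; first exact: measurable_nneg.
  by move=> t /andP[].
- by move=> t t0; apply: le_trans (blocked_rate_norm _ _ _) (bf _ t0).
- move=> t t0; rewrite {1}/e (eH 0 0)// ?mul0r//.
  have [HN0 _ _ [_ _ ->//]] := HP (N t); have [-> _ _ _] := HP 0; rewrite HN0.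
  congr (_ + _); apply: eq_Rintegral => s; rewrite inE => /andP[s0 st].
  by apply: pH => //; exact: le_trans st (tN t).
Qed.

End TwoSidedReflection.

(** * Comparison with a rival store *)

Section GreedyOptimality.
Context {R : realType}.
Local Notation mu := (@lebesgue_measure R).
Local Notation Rnneg := [set t : R | 0 <= t].
Implicit Types (F f e psi : R -> R) (L M s t u v x y b c : R).

(** Output of the single store into which all stores merge, with energy [y]. A negative value is an
    internal charging rate, counted after the loss [eta]. *)
Definition greedy_rate (p alpha eta cap y d : R) : R :=
  if 0 <= d then Num.min d (if 0 < y then p else 0)
  else - Num.min (eta * `|d|) (if y < cap then alpha * p else 0).

(** When not empty, the greedy store has the least possible shortfall. When not full, it never
    outputs more than a nonnegative [d], so any extra output counts in full against the shortfall;
    and for [d < 0] it charges at least as fast as the rival. *)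
Lemma shortfall_le (p alpha eta cap y d r : R) (w := fun z => Num.max (d - z) 0)
    (r0 := greedy_rate p alpha eta cap y d) :
  0 <= p -> 0 < alpha -> 0 < eta <= 1 -> r <= p -> - (alpha * p) <= r ->
  (d < 0 -> eta * d <= r) ->
  [/\ `|w r - w r0| <= `|r0 - r|, 0 < y -> 0 <= w r - w r0 &
      y < cap -> 0 <= w r - w r0 - (r0 - r)].
Proof.
move=> p0 alpha0 /andP[eta0 eta1] rp ralpha rd.
have lipw a c : `|w a - w c| <= `|c - a|.
  have := ler_norm (c - a); have := ler_norm (- (c - a)); rewrite normrN.
  rewrite /w ler_norml; case: (leP (d - a) 0) => ?; case: (leP (d - c) 0) => ?;
  by lra.
(* As [eta <= 1], greedy charging stays within the surplus and causes no shortfall. *)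
have dmin c : d < 0 -> d <= - Num.min (eta * `|d|) c.
  move=> dneg; rewrite lerNr ge_min ltr0_norm//; apply/orP; left.
  by rewrite ler_piMl// oppr_ge0 ltW.
split => //; rewrite /w /r0 /greedy_rate.
- case: (leP 0 d) => [d0 ->|dneg _] /=.
    case: (leP d p) => dp; first by rewrite subrr maxxx subr0 le_max lexx orbT.
    by case: (leP (d - r) 0) => ?; case: (leP (d - p) 0) => ?; lra.
  have := dmin (if y < cap then alpha * p else 0) dneg; set z := - _ => dz.
  by case: (leP (d - r) 0) => ?; case: (leP (d - z) 0) => ?; lra.
- case: (leP 0 d) => [d0|dneg] ycap.
    have : Num.min d (if 0 < y then p else 0) <= d by rewrite ge_min lexx.
    set z := Num.min _ _ => zd.
    by case: (leP (d - r) 0) => ?; case: (leP (d - z) 0) => ?; lra.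
  rewrite ycap; have := dmin (alpha * p) dneg.
  have : - Num.min (eta * `|d|) (alpha * p) <= r.
    rewrite lerNl le_min ltr0_norm// mulrN lerN2 rd//=; lra.
  set z := - _ => zr dz.
  by case: (leP (d - r) 0) => ?; case: (leP (d - z) 0) => ?; lra.
Qed.

Section Comparison.
Variables (p alpha eta cap : R) (d E E' r r' : R -> R) (L M : R).
Hypotheses (p_ge0 : 0 <= p) (alpha_gt0 : 0 < alpha) (eta01 : 0 < eta <= 1)
  (cap_gt0 : 0 < cap) (dE : has_density E (fun t => - r t) L)
  (dE' : has_density E' (fun t => - r' t) M) (E00 : E 0 = E' 0)
  (md : measurable_fun Rnneg d)
  (greedy : forall t, 0 <= t -> r t = greedy_rate p alpha eta cap (E t) (d t))
  (E'01 : forall t, 0 <= t -> 0 <= E' t <= cap)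
  (r'p : forall t, 0 <= t -> - (alpha * p) <= r' t <= p)
  (r'd : forall t, 0 <= t -> d t < 0 -> eta * d t <= r' t).

Let w (z : R -> R) t := Num.max (d t - z t) 0.
Let g t := 0 + \int[mu]_(s in interval0 t) (w r' s - w r s).

Let mr : measurable_fun Rnneg r.
Proof.
case: dE => /measurable_funN mNr _ _.
by apply: eq_measurable_fun mNr => t _ /=; rewrite opprK.
Qed.

Let mr' : measurable_fun Rnneg r'.
Proof.
case: dE' => /measurable_funN mNr _ _.
by apply: eq_measurable_fun mNr => t _ /=; rewrite opprK.
Qed.

Lemma measurable_shortfall (z : R -> R) : measurable_fun Rnneg z ->
  measurable_fun Rnneg (fun t => Num.max (d t - z t) 0).
Proof.
move=> mz; apply: measurable_maxr; last exact: measurable_cst.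
exact: measurable_funB.
Qed.

Let key t : 0 <= t -> [/\ `|w r' t - w r t| <= `|r t - r' t|,
  0 < E t -> 0 <= w r' t - w r t &
  E t < cap -> 0 <= w r' t - w r t - (- r' t - - r t)].
Proof.
move=> t0; have /andP[r'1 r'2] := r'p t0.
have [] := shortfall_le cap (E t) p_ge0 alpha_gt0 eta01 r'2 r'1 (r'd t0).
rewrite -greedy// => H1 H2 H3; split => // /H3.
by rewrite opprK (addrC (- r' t)).
Qed.

Let dg : has_density g (fun t => w r' t - w r t) (L + M).
Proof.
apply: has_density_int; first by apply: measurable_funB; exact: measurable_shortfall.
move=> t t0; have [H _ _] := key t0; apply: (le_trans H).
case: dE => _ bE _; case: dE' => _ bE' _.
have := bE _ t0; have := bE' _ t0; rewrite !normrN => H1 H2.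
by apply: (le_trans (ler_normB _ _)); rewrite lerD.
Qed.

Let dD : has_density (fun t => E' t - E t) (fun t => - r' t - - r t) (M + L).
Proof. exact: has_densityB. Qed.

(* [g t] is the excess unserved energy of the rival, and [E' t - E t] its
   excess stored energy: the former dominates the positive part of the
   latter. *)
Lemma excess_step a t : 0 <= a -> a <= t -> L * (t - a) < cap / 2 ->
  0 <= g a -> E' a - E a <= g a -> 0 <= g t /\ E' t - E t <= g t.
Proof.
move=> a0 at_ Lt ga Da; have L0 := density_bound_ge0 dE.
have dgD := has_densityB dg dD.
have near u : a <= u <= t -> `|E u - E a| < cap / 2.
  move=> /andP[au ut]; apply: (le_lt_trans (density_lip dE a0 au)).
  by apply: le_lt_trans Lt; rewrite ler_wpM2l// lerB.
have a_le u : a <= u -> 0 <= u by exact: le_trans.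
(* The step is too short for the energy to move by [cap / 2]: from the lower half the store does not
   get full, from the upper half it does not get empty. *)
have [Ea|Ea] := leP (E a) (cap / 2).
  have lt_cap u : a <= u <= t -> E u < cap.
    by move=> /near; rewrite ltr_norml; lra.
  have gD u : a <= u <= t -> E' u - E u <= g u.
    move=> /andP[au ut]; rewrite -subr_ge0.
    apply: (@le_trans _ _ (g a - (E' a - E a))); first by rewrite subr_ge0.
    apply: (density_mono dgD) => // v /andP[/ltW av vu].
    by have [_ _] := key (a_le _ av); apply; apply: lt_cap; rewrite av (le_trans vu).
  split; last by apply: gD; rewrite at_ lexx.
  (* If [g u] were negative, so would be [E' u - E u]; then [E u > E' u >= 0], and a nonempty greedy
     store makes the density of [g] nonnegative. *)
  apply: (density_nneg dg a0 at_ ga) => u /andP[au ut] gu.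
  have [_ + _] := key (a_le _ au); apply.
  have := gD u; rewrite au ut => /(_ isT).
  by have /andP[+ _] := E'01 (a_le _ au); lra.
have gt0 u : a <= u <= t -> 0 < E u.
  by move=> /near; rewrite ltr_norml; lra.
have gmono u : a <= u <= t -> 0 <= g u.
  move=> /andP[au ut]; apply: (le_trans ga).
  apply: (density_mono dg) => // v /andP[/ltW av vu].
  by have [_ + _] := key (a_le _ av); apply; apply: gt0; rewrite av (le_trans vu).
split; first by apply: gmono; rewrite at_ lexx.
(* Where [E' u - E u] exceeds [g u >= 0], the greedy store holds less than the rival and so is not
   full. *)
rewrite -subr_ge0; apply: (density_nneg dgD a0 at_); first by rewrite subr_ge0.
move=> u /andP[au ut]; rewrite subr_lt0 => gu.
have [_ _] := key (a_le _ au); apply.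
have gu0 : 0 <= g u by apply: gmono; rewrite au ut.
have /andP[_ Ecap] := E'01 (a_le _ au).
by apply: lt_le_trans Ecap; rewrite -subr_gt0; exact: le_lt_trans gu.
Qed.

Lemma excess_ge0 t : 0 <= t -> 0 <= \int[mu]_(s in interval0 t) (w r' s - w r s).
Proof.
move=> t0; have L0 := density_bound_ge0 dE.
have L1 : 0 < L + 1 by rewrite ltr_wpDl.
pose h := cap / (4 * (L + 1)).
have h0 : 0 < h by rewrite divr_gt0// mulr_gt0.
have Lh : L * h < cap / 2.
  have : (L + 1) * h = cap / 4 by rewrite /h; field; rewrite gt_eqF.
  by move: cap_gt0 h0; rewrite mulrDl mul1r; lra.
have step a u : 0 <= a -> a <= u -> u <= a + h -> 0 <= g a -> E' a - E a <= g a ->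
    0 <= g u /\ E' u - E u <= g u.
  move=> a0 au uh; apply: excess_step => //; apply: le_lt_trans Lh.
  by rewrite ler_wpM2l// lerBlDl.
have g0 : g 0 = 0.
  rewrite /g add0r (_ : interval0 0 = [set 0]) ?Rintegral_set1//.
  by rewrite interval0E set_itv1.
have grid n : 0 <= g (n%:R * h) /\ E' (n%:R * h) - E (n%:R * h) <= g (n%:R * h).
  elim: n => [|n [IH1 IH2]]; first by rewrite mul0r g0 E00 subrr.
  have nh : 0 <= n%:R * h by rewrite mulr_ge0// ltW.
  by apply: (step (n%:R * h)) => //; rewrite -natr1 mulrDl mul1r ?lerDl// ltW.
pose n := Num.truncn (t / h).
have [/andP[nt tn]] : n%:R <= t / h < n.+1%:R by exact/truncn_itv/divr_ge0/ltW.
have [g1 g2] := grid n.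
have nh : 0 <= n%:R * h by rewrite mulr_ge0// ltW.
have nht : n%:R * h <= t by rewrite -ler_pdivlMr.
have tnh : t <= n%:R * h + h.
  by rewrite -[X in _ + X]mul1r -mulrDl natr1 -ler_pdivrMr// ltW.
by have [+ _] := step _ _ nh nht tnh g1 g2; rewrite /g add0r.
Qed.

Lemma greedy_shortfall_le t : 0 <= t -> mu.-integrable (interval0 t) (EFin \o d) ->
  (\int[mu]_(s in interval0 t) (w r s)%:E <=
   \int[mu]_(s in interval0 t) (w r' s)%:E)%E.
Proof.
move=> t0 intd.
have mI : measurable (interval0 t) by rewrite interval0E; exact: measurable_itv.
have sub0 : interval0 t `<=` Rnneg by move=> s /andP[].
have intw (z : R -> R) K : measurable_fun Rnneg z ->
    (forall s, 0 <= s -> `|- z s| <= K) ->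
    mu.-integrable (interval0 t) (EFin \o w z).
  move=> mz bz.
  have intz : mu.-integrable (interval0 t) (EFin \o z).
    rewrite interval0E; apply: (@bounded_integrable _ _ K) => // s s0.
    by rewrite -normrN; exact: bz.
  have := @integrableB _ _ _ mu _ mI _ _ intd intz.
  apply: (@le_integrable _ _ _ mu _ mI).
    apply/measurable_EFinP; apply: measurable_funS (measurable_shortfall mz) => //.
    exact: measurable_nneg.
  move=> s _; rewrite /= lee_fin /w /Num.max.
  by case: ltP => [|_ //]; rewrite normr0.
have intr : mu.-integrable (interval0 t) (EFin \o w r).
  by case: (dE) => _ bE _; exact: intw bE.
have intr' : mu.-integrable (interval0 t) (EFin \o w r').
  by case: (dE') => _ bE' _; exact: intw bE'.
have := excess_ge0 t0; rewrite RintegralB// subr_ge0 -lee_fin /Rintegral.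
by rewrite !fineK//; apply: integrable_fin_num.
Qed.

End Comparison.
End GreedyOptimality.

(** * Policies *)

Section Policies.
Context {R : realType} {I : finType}.
Local Notation mu := (@lebesgue_measure R).
Local Notation Rnneg := [set t : R | 0 <= t].
Variables (Ebar P P' E0 : I -> R) (alpha eta : R).
Hypotheses (Ebar_gt0 : forall i, 0 < Ebar i) (P_gt0 : forall i, 0 < P i)
  (alpha_gt0 : 0 < alpha) (P'E : forall i, P' i = alpha * P i)
  (eta01 : 0 < eta <= 1)
  (Ebar_prop : forall i j, Ebar i / P i = Ebar j / P j)
  (E0_prop : forall i j, E0 i / P i = E0 j / P j)
  (E0_bounds : forall i, 0 <= E0 i <= Ebar i).
Implicit Types (d : R -> R) (r : I -> R -> R) (T : \bar R) (t : R).

Let P'_gt0 i : 0 < P' i. Proof. by rewrite P'E mulr_gt0. Qed.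

Lemma energy_density r i M : is_policy r ->
  (forall t, 0 <= t -> - M <= r i t <= M) ->
  has_density (energy E0 r i) (fun t => - r i t) M.
Proof.
move=> mr br.
have bN t : 0 <= t -> `|- r i t| <= M by move=> t0; rewrite normrN ler_norml br.
have dI : has_density (fun t => 0 + \int[mu]_(s in interval0 t) r i s) (r i) M.
  by apply: has_density_int => // t /bN; rewrite normrN.
apply: has_density_bound bN.
apply: eq_density (has_densityB (has_density_cst (E0 i)) dI) _ _ => t t0 /=.
  by rewrite add0r.
by rewrite sub0r.
Qed.

Lemma energy0 r i : energy E0 r i 0 = E0 i.
Proof.
rewrite /energy (_ : interval0 0 = [set 0]) ?Rintegral_set1 ?subr0//.
by rewrite interval0E set_itv1.
Qed.

Lemma ggddf_rates_bounds E x dt : ggddf_rates P E dt x ->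
  forall i, 0 <= x i <= P i /\ (E i <= 0 -> x i = 0).
Proof.
move=> [tau [lam [/andP[l0 l1] [xE _]]]] i; rewrite xE; split; last first.
  by rewrite leNgt => /negbTE ->.
case: ifP => _; first by rewrite lexx ltW.
case: ifP => _; last by rewrite lexx ltW.
by rewrite mulr_ge0 ?(ltW l0) ?(ltW (P_gt0 i))//= ler_piMl// ltW.
Qed.

Lemma ggcdf_rates_bounds E x dt : ggcdf_rates Ebar P' eta E dt x ->
  forall i, - P' i <= x i <= 0 /\ (Ebar i <= E i -> x i = 0).
Proof.
move=> [tau [lam [/andP[l0 l1] [xE _]]]] i; rewrite xE; split; last first.
  by rewrite leNgt => /negbTE ->.
have P'i := P'_gt0 i.
case: ifP => _; first by rewrite lexx oppr_le0 ltW.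
case: ifP => _; last by rewrite lexx oppr_le0 ltW.
by rewrite lerN2 oppr_le0 mulr_ge0 ?(ltW l0) ?(ltW P'i)// andbT ler_piMl// ltW.
Qed.

(** * Properties and optimality of a given greedy policy *)

Section GreedyPolicy.
Variables (d : R -> R) (r : I -> R -> R).
Hypothesis ggr : gg_policy Ebar P P' eta E0 d r.
Let E i t := energy E0 r i t.

Lemma gg_rate_bounds i t : 0 <= t ->
  - P' i <= r i t <= P i /\
  ((E i t < 0 -> r i t <= 0) /\ (Ebar i < E i t -> 0 <= r i t)).
Proof.
move=> t0; have [ddf cdf] := ggr.2 t t0.
have Pi := P_gt0 i; have P'i := P'_gt0 i.
have [d0|dneg] := leP 0 (d t).
  have [/andP[x0 xP] xE] := ggddf_rates_bounds (ddf d0) i.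
  split; first by rewrite xP andbT (le_trans _ x0)// oppr_le0 ltW.
  split; last by [].
  by move=> /ltW/xE ->.
have [/andP[x0 xP] xE] := ggcdf_rates_bounds (cdf dneg) i.
split; first by rewrite x0/= (le_trans xP)// ltW.
split; first by [].
by move=> /ltW/xE ->.
Qed.

Lemma gg_energy_density i :
  has_density (E i) (fun t => - r i t) (P i + P' i).
Proof.
apply: energy_density; first exact: ggr.1.
move=> t /(gg_rate_bounds i)[/andP[H1 H2] _].
by have Pi := P_gt0 i; have P'i := P'_gt0 i; apply/andP; split; lra.
Qed.

(** The greedy rules do not impose these bounds; they follow because an empty store never discharges
    and a full one never charges. *)
Lemma gg_energy_bounds i t : 0 <= t -> 0 <= E i t <= Ebar i.
Proof.
move=> t0; have dE := gg_energy_density i; have /andP[E00 E0b] := E0_bounds i.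
apply/andP; split.
  apply: (density_nneg dE (lexx _) t0); first by rewrite /E energy0.
  move=> u /andP[u0 _]; rewrite oppr_ge0.
  by have [_ []] := gg_rate_bounds i u0.
rewrite -subr_ge0.
apply: (density_nneg (has_densityB (has_density_cst (Ebar i)) dE) (lexx _) t0).
  by rewrite /E energy0 subr_ge0.
move=> u /andP[u0 _]; rewrite /= subr_lt0 sub0r opprK.
by have [_ [_]] := gg_rate_bounds i u0.
Qed.

(** Were the duration of [k] above that of [l], then [k] would discharge at no smaller a fraction of
    its power, and [l] would charge at no smaller a fraction, so the gap cannot open. Proportional
    capacities and [P' = alpha P] make charge durations order the stores in reverse. *)
Lemma gg_sync i j t : 0 <= t -> E i t / P i = E j t / P j.
Proof.
move=> t0.
suff H k l : E k t / P k <= E l t / P l by apply/eqP; rewrite eq_le !H.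
rewrite -subr_ge0 mulrC (mulrC (E k t)).
apply: (density_nneg (has_densityB
  (has_densityZ (P l)^-1 (gg_energy_density l))
  (has_densityZ (P k)^-1 (gg_energy_density k))) (lexx _) t0).
  by rewrite /E !energy0 mulrC (mulrC _ (E0 k)) (E0_prop k l) subrr.
move=> u /andP[u0 _]; rewrite subr_lt0 !mulrN opprK addrC subr_ge0 => Elk.
rewrite mulrC [leRHS]mulrC; rewrite mulrC (mulrC _ (E k u)) in Elk.
have Pk := P_gt0 k; have Pl := P_gt0 l.
have /andP[El _] := gg_energy_bounds l u0.
have /andP[_ Ek] := gg_energy_bounds k u0.
(* The strict gap makes [k] nonempty and [l] non-full, so the rules exclude neither from the
   relevant grouping. *)
have Ek0 : 0 < E k u.
  have : 0 <= E l u / P l by rewrite divr_ge0// ltW.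
  by move=> /le_lt_trans/(_ Elk); rewrite pmulr_lgt0 ?invr_gt0.
have Ell : E l u < Ebar l.
  have : E k u / P k <= Ebar k / P k by rewrite ler_pM2r ?invr_gt0.
  by move=> /(lt_le_trans Elk); rewrite (Ebar_prop k l) ltr_pM2r ?invr_gt0.
have [ddf cdf] := ggr.2 u u0.
have [d0|dneg] := leP 0 (d u).
  have [tau [lam [/andP[l0 l1] [xE _]]]] := ddf d0.
  have rl : r l u / P l <= 1.
    by rewrite ler_pdivrMr// mul1r; have [/andP[]] := ggddf_rates_bounds (ddf d0) l.
  have rk : 0 <= r k u / P k.
    by rewrite divr_ge0 ?(ltW Pk)//; have [/andP[]] := ggddf_rates_bounds (ddf d0) k.
  (* Either [k] is above the threshold and runs at full power, or [l] is below it and idle. *)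
  have [tauk|] := ltP tau (E k u / P k).
    by rewrite [r k u]xE Ek0 tauk /= divff ?gt_eqF.
  move=> /(lt_le_trans Elk) ltau.
  rewrite [r l u]xE (ltNge tau) (ltW ltau) andbF (lt_eqF ltau) andbF mul0r.
  exact: rk.
have [tau [lam [/andP[l0 l1] [xE _]]]] := cdf dneg.
have rl : - alpha <= r l u / P l.
  rewrite ler_pdivlMr// mulNr -P'E.
  by have [/andP[]] := ggcdf_rates_bounds (cdf dneg) l.
have rk : r k u / P k <= 0.
  rewrite pmulr_lle0 ?invr_gt0//.
  by have [/andP[]] := ggcdf_rates_bounds (cdf dneg) k.
have rlk0 : r l u / P l <= 0.
  rewrite pmulr_lle0 ?invr_gt0//.
  by have [/andP[]] := ggcdf_rates_bounds (cdf dneg) l.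
have durE m : (Ebar m - E m u) / P' m = (Ebar m / P m - E m u / P m) / alpha.
  rewrite P'E; field; rewrite gt_eqF ?P_gt0//= gt_eqF//.
have dur : (Ebar k - E k u) / P' k < (Ebar l - E l u) / P' l.
  by rewrite !durE ltr_pM2r ?invr_gt0// (Ebar_prop l k) ltrD2l ltrN2.
have [taul|] := ltP tau ((Ebar l - E l u) / P' l).
  rewrite [r l u]xE Ell taul /= P'E.
  rewrite mulNr -mulrA divff ?gt_eqF// mulr1.
  rewrite ler_pdivlMr// mulNr -P'E.
  by have [/andP[]] := ggcdf_rates_bounds (cdf dneg) k.
move=> /(lt_le_trans dur) ltau.
rewrite [r k u]xE (ltNge tau) (ltW ltau) andbF (lt_eqF ltau) andbF mul0r.
exact: rlk0.
Qed.

Let p := \sum_i P i.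
Let cap := \sum_i Ebar i.

Lemma sum_capacities_gt0 (i0 : I) : 0 < p /\ 0 < cap.
Proof.
by split; rewrite /p /cap (bigD1 i0)//= ltr_pwDl// sumr_ge0// => i _; rewrite ltW.
Qed.

(** By [gg_sync] all energies are [P i * e] for a common [e], so the stores become empty, or full,
    together and each sum over eligible stores is all or nothing. *)
Lemma gg_total_rate (i0 : I) t : 0 <= t ->
  \sum_i r i t = greedy_rate p alpha eta cap (\sum_i E i t) (d t).
Proof.
move=> t0; have [p0 _] := sum_capacities_gt0 i0.
pose e := E i0 t / P i0; pose b := Ebar i0 / P i0.
have EE i : E i t = P i * e.
  by rewrite /e -(gg_sync i)// mulrC divfK// gt_eqF.
have EbarE i : Ebar i = P i * b.
  by rewrite /b -(Ebar_prop i) mulrC divfK// gt_eqF.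
have sumE : \sum_i E i t = p * e.
  by rewrite mulr_suml; apply: eq_bigr => i _; exact: EE.
have capE : cap = p * b.
  by rewrite mulr_suml; apply: eq_bigr => i _; exact: EbarE.
have [ddf cdf] := ggr.2 t t0.
rewrite /greedy_rate sumE capE pmulr_rgt0// ltr_pM2l//.
have [d0|dneg] := leP 0 (d t).
  have [tau [lam [_ [_ ->]]]] := ddf d0; congr (Num.min _ _).
  rewrite (eq_bigl (fun=> 0 < e)); last first.
    by move=> i; rewrite -/(E i t) EE pmulr_rgt0.
  by case: ifP => _ //; rewrite big_pred0_eq.
have [tau [lam [_ [_ H]]]] := cdf dneg.
rewrite -[LHS]opprK H; congr (- Num.min _ _).
rewrite (eq_bigl (fun=> e < b)); last first.
  by move=> i; rewrite -/(E i t) EE EbarE ltr_pM2l.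
case: ifP => _; last by rewrite big_pred0_eq.
by rewrite mulr_sumr; apply: eq_bigr => i _; exact: P'E.
Qed.

(** At each instant all rates have the same sign, so one of the two sums in [net_rate] vanishes. *)
Lemma gg_admissible : admissible Ebar P P' eta E0 d r.
Proof.
split=> [|t t0]; first exact: ggr.1.
split=> [i|i|]; [exact: gg_energy_bounds|by have [] := gg_rate_bounds i t0|].
have /andP[eta0 eta1] := eta01.
have [ddf cdf] := ggr.2 t t0; rewrite /net_rate.
have [d0|dneg] := leP 0 (d t).
  have x0 i : 0 <= r i t by have [/andP[]] := ggddf_rates_bounds (ddf d0) i.
  rewrite (eq_bigl xpredT)// [X in _ * X]big_pred0; last first.
    by move=> i; rewrite ltNge x0.
  rewrite mulr0 addr0 sumr_ge0//=.
  by have [tau [lam [_ [_ ->]]]] := ddf d0; rewrite ge_min lexx.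
have x0 i : r i t <= 0 by have [/andP[]] := ggcdf_rates_bounds (cdf dneg) i.
rewrite big1 ?add0r; last by move=> i xi; apply/eqP; rewrite eq_le x0.
have -> : \sum_(i | r i t < 0) r i t = \sum_i r i t.
  rewrite [RHS](bigID (fun i => r i t < 0))/= [X in _ + X]big1 ?addr0// => i.
  by rewrite -leNgt => xi; apply/eqP; rewrite eq_le x0.
rewrite pmulr_rle0 ?invr_gt0// sumr_le0 ?andbT//.
rewrite -(ler_pM2l eta0) mulrA divff ?gt_eqF// mul1r.
have [tau [lam [_ [_ H]]]] := cdf dneg.
by rewrite -lerN2 H ltr0_norm// ge_min mulrN lexx.
Qed.

(** Multiplying the surplus constraint by [eta] leaves discharges weighted by [eta <= 1]. Dropping
    that weight only enlarges the total, so cross-charging gains nothing for the merged store. *)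
Lemma admissible_total_rate r' t : admissible Ebar P P' eta E0 d r' -> 0 <= t ->
  - (alpha * p) <= \sum_i r' i t <= p /\
  (d t < 0 -> eta * d t <= \sum_i r' i t).
Proof.
move=> [_ adm] t0; have [_ rb /andP[netd _]] := adm t t0.
have /andP[eta0 eta1] := eta01.
split.
  rewrite mulr_sumr -sumrN; apply/andP; split; apply: ler_sum => i _.
    by rewrite -P'E; have /andP[] := rb i.
  by have /andP[] := rb i.
move=> dneg; move: netd; rewrite (min_idPl (ltW dneg)) /net_rate => netd.
rewrite (bigID (fun i => 0 <= r' i t))/=.
rewrite [X in _ + X](eq_bigl (fun i => r' i t < 0)); last first.
  by move=> i; rewrite ltNge.
move: netd; set pos := \sum_(i | _) _; set neg := \sum_(i | _) _ => netd.
have pos0 : 0 <= pos by exact: sumr_ge0.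
move: netd; rewrite -(ler_pM2l eta0) mulrDr mulrA divff ?gt_eqF// mul1r.
move=> /le_trans; apply; rewrite lerD2r.
by rewrite ler_piMl.
Qed.

Lemma loc_integrable_measurable : loc_integrable d -> measurable_fun Rnneg d.
Proof.
move=> intd.
have -> : Rnneg = \bigcup_n interval0 n%:R.
  apply/seteqP; split => [t t0|t [n _ /andP[]//]].
  exists (Num.truncn t).+1 => //.
  by rewrite /interval0/= t0 ltW// truncnS_gt.
apply/measurable_fun_bigcup => n.
  by rewrite interval0E; exact: measurable_itv.
by apply/measurable_EFinP; have /measurable_int := intd n%:R (ler0n _ _).
Qed.

Lemma gg_shortfall_le (i0 : I) r' t : loc_integrable d ->
  admissible Ebar P P' eta E0 d r' -> 0 <= t ->
  (\int[mu]_(s in interval0 t) (Num.max (d s - \sum_i r i s) 0)%:E <=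
   \int[mu]_(s in interval0 t) (Num.max (d s - \sum_i r' i s) 0)%:E)%E.
Proof.
move=> intd adm t0.
have [p0 cap0] := sum_capacities_gt0 i0.
have sumN (x : I -> R -> R) s : \sum_i - x i s = - \sum_i x i s by rewrite sumrN.
have dE : has_density (fun t => \sum_i E i t) (fun t => - \sum_i r i t)
    (\sum_i (P i + P' i)).
  by apply: eq_density (has_density_sum gg_energy_density) _ _ => // s _.
have dE'i i : has_density (energy E0 r' i) (fun t => - r' i t) (P i + P' i).
  apply: energy_density; first exact: adm.1.
  move=> s s0; have [_ /(_ i)/andP[H1 H2] _] := adm.2 s s0.
  by have Pi := P_gt0 i; have P'i := P'_gt0 i; apply/andP; split; lra.
have dE' : has_density (fun t => \sum_i energy E0 r' i t)
    (fun t => - \sum_i r' i t) (\sum_i (P i + P' i)).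
  by apply: eq_density (has_density_sum dE'i) _ _ => // s _.
apply: (greedy_shortfall_le (ltW p0) alpha_gt0 eta01 cap0 dE dE') => //.
- by apply: eq_bigr => i _; rewrite /E !energy0.
- exact: loc_integrable_measurable.
- by move=> s s0; exact: gg_total_rate.
- move=> s s0; have [Eb _ _] := adm.2 s s0.
  apply/andP; split; first by apply: sumr_ge0 => i _; have /andP[] := Eb i.
  by apply: ler_sum => i _; have /andP[] := Eb i.
- by move=> s s0; have [] := admissible_total_rate adm s0.
- by move=> s s0; have [] := admissible_total_rate adm s0.
- exact: intd.
Qed.

Lemma gg_optimal r' T : loc_integrable d -> admissible Ebar P P' eta E0 d r' ->
  (0 < T)%E -> (unserved T d r <= unserved T d r')%E.
Proof.
move=> intd adm; rewrite /unserved.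
(* Without stores all total rates are zero and the two sides coincide. *)
have [i0 _|I0] := pickP (fun _ : I => true); last first.
  have sum0 (x : I -> R -> R) s : \sum_i x i s = 0.
    by apply: big1 => i; have := I0 i.
  move=> _; rewrite le_eqVlt; apply/orP; left; apply/eqP.
  by apply: eq_integral => s _; rewrite !sum0.
case: T => [T|_|//].
  rewrite lte_fin => T0.
  have -> : horizon T%:E = interval0 T.
    apply/seteqP; split => s /=; rewrite /horizon /interval0/= lee_fin.
      by move=> [-> ->].
    by move=> /andP.
  exact/(gg_shortfall_le i0)/ltW.
(* The infinite horizon is the monotone limit of the horizons [n]. *)
have -> : horizon +oo%E = \bigcup_n interval0 (n%:R : R).
  apply/seteqP; split => [s [s0 _]|s [n _ /andP[s0 _]]].
    by exists (Num.truncn s).+1 => //; rewrite /interval0/= s0 ltW// truncnS_gt.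
  by split => //; rewrite leey.
have md := loc_integrable_measurable intd.
have cvgw (x : I -> R -> R) : is_policy x ->
    (\int[mu]_(s in interval0 n%:R) (Num.max (d s - \sum_i x i s) 0)%:E)%E
      @[n --> \oo] -->
    (\int[mu]_(s in \bigcup_n interval0 n%:R) (Num.max (d s - \sum_i x i s) 0)%:E)%E.
  move=> mx.
  have mI n : measurable (interval0 (n%:R : R)).
    by rewrite interval0E; exact: measurable_itv.
  apply: ge0_nondecreasing_set_cvg_integral.
  - move=> m n mn; apply/subsetPset => s /andP[s0 sm].
    by rewrite /interval0/= s0 (le_trans sm)// ler_nat.
  - exact: mI.
  - move=> n; apply/measurable_EFinP.
    apply: (@measurable_funS _ _ _ _ Rnneg) => //.
    + exact: measurable_nneg.
    + by move=> s /andP[].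
    + by apply: measurable_shortfall => //; exact: measurable_sum.
  - by move=> n s _; rewrite lee_fin le_max lexx orbT.
apply: lee_cvg_to (cvgw r ggr.1) (cvgw r' adm.1) _.
by apply: nearW => n; exact: gg_shortfall_le.
Qed.

End GreedyPolicy.

(** * Construction of a non-anticipatory greedy policy *)

Section Construction.
Variable i0 : I.
Let p := \sum_i P i.
Let b := Ebar i0 / P i0.
Let x0 := E0 i0 / P i0.

Let p_gt0 : 0 < p. Proof. by have [] := sum_capacities_gt0 i0. Qed.
Let b_gt0 : 0 < b. Proof. exact: divr_gt0. Qed.

Let x0_bounds : 0 <= x0 <= b.
Proof.
have /andP[E00 E0b] := E0_bounds i0.
by rewrite divr_ge0 ?(ltW (P_gt0 i0))//= ler_pM2r ?invr_gt0.
Qed.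

(* the charging rate of every store, per unit of [P i], before blocking at
   the empty and full states *)
Definition unit_rate (v : R) : R :=
  if 0 <= v then - Num.min (v / p) 1 else Num.min (eta * `|v| / p) alpha.

Lemma unit_rate_norm v : `|unit_rate v| <= 1 + alpha.
Proof.
have /andP[eta0 _] := eta01.
rewrite /unit_rate; case: (leP 0 v) => [v0|vneg].
  have m0 : 0 <= Num.min (v / p) 1 by rewrite le_min ler01 divr_ge0// ltW.
  rewrite normrN ger0_norm//; apply: (@le_trans _ _ 1).
    by rewrite ge_min lexx orbT.
  by rewrite lerDl ltW.
have m0 : 0 <= Num.min (eta * `|v| / p) alpha.
  by rewrite le_min (ltW alpha_gt0) andbT !mulr_ge0// ?invr_ge0// ltW.
rewrite ger0_norm//; apply: (@le_trans _ _ alpha).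
  by rewrite ge_min lexx orbT.
by rewrite lerDr.
Qed.

Lemma measurable_unit_rate d : measurable_fun Rnneg d ->
  measurable_fun Rnneg (fun t => unit_rate (d t)).
Proof.
move=> md.
have mcst c : measurable_fun Rnneg (cst c : R -> R) by exact: measurable_cst.
apply: measurable_fun_if.
- exact: measurable_nneg.
- exact: measurable_fun_ler.
- apply: (@measurable_funS _ _ _ _ Rnneg) => //; first exact: measurable_nneg.
  apply: measurable_funN; apply: measurable_minr => //.
  exact: measurable_funM.
- apply: (@measurable_funS _ _ _ _ Rnneg) => //; first exact: measurable_nneg.
  apply: measurable_minr => //; apply: measurable_funM => //.
  by apply: measurable_funM => //; exact: measurableT_comp.
Qed.

(** Store [i] holds [P i * e t], so all durations are equal and the stores form a single group,
    which is the last needed one. *)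
Lemma gg_policy_of_solution d r e L :
  has_density e (fun t => blocked_rate b (e t) (unit_rate (d t))) L ->
  e 0 = x0 ->
  (forall i t, 0 <= t ->
     r i t = - P i * blocked_rate b (e t) (unit_rate (d t))) ->
  gg_policy Ebar P P' eta E0 d r.
Proof.
move=> de e0 rE; split.
  move=> i; have [mq _ _] := has_densityZ (- P i) de.
  by apply: eq_measurable_fun mq => t; rewrite inE/= => t0; rewrite rE.
have EE i t : 0 <= t -> energy E0 r i t = P i * e t.
  move=> t0; have [_ _ /(_ t t0)] := has_densityZ (- P i) de.
  rewrite e0 mulNr /energy.
  rewrite (@eq_Rintegral _ _ _ mu _ (r i)); last first.
    by move=> s; rewrite inE => /andP[s0 _]; rewrite rE.
  have -> : E0 i = P i * x0.
    by rewrite /x0 (E0_prop i0 i) mulrC divfK// gt_eqF.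
  by rewrite mulNr; lra.
have EbarE i : Ebar i = P i * b.
  by rewrite /b (Ebar_prop i0 i) mulrC divfK// gt_eqF.
have /andP[eta0 eta1] := eta01.
move=> t t0; split=> [d0|dneg].
  pose rho := Num.min (d t / p) 1.
  have rho0 : 0 <= rho by rewrite le_min ler01 divr_ge0// ltW.
  have rrho i : r i t = P i * (if 0 < e t then rho else 0).
    rewrite rE// /unit_rate d0 -/rho /blocked_rate oppr_lt0 oppr_gt0.
    rewrite (ltNge rho 0) rho0 andbF orbF leNgt.
    case: (ltP 0 (e t)) => _ /=; first by rewrite mulrNN.
    by case: (ltgtP 0 rho) rho0 => // [_|<-] _; rewrite ?oppr0 !mulr0.
  exists (if 0 < rho then e t else e t + 1), (if 0 < rho then rho else 1).
  split.
    by case: ifP => [->|_]; rewrite ?ltr01 ?lexx//= ge_min lexx orbT.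
  split=> [i|].
    have durE : P i * e t / P i = e t by rewrite mulrAC divff ?mul1r ?gt_eqF.
    rewrite rrho EE// durE.
    rewrite pmulr_rgt0//. case: (ltP 0 (e t)) => _ /=; last by rewrite mulr0.
    case: (ltgtP 0 rho) rho0 => // [_|<-] _.
      by rewrite ltxx eqxx mulrC.
    by rewrite /= ltNge lerDl ler01/= lt_eqF ?ltrDl// mulr0.
  under eq_bigr do rewrite rrho; rewrite -mulr_suml -/p.
  rewrite (eq_bigl (fun=> 0 < e t)); last by move=> i; rewrite EE// pmulr_rgt0.
  case: ifP => _; last by rewrite mulr0 big_pred0_eq (min_idPr d0).
  by rewrite /rho minr_pMr ?ltW// mulr1 mulrC divfK// gt_eqF.
pose rho := Num.min (eta * `|d t| / p) alpha.
have rho0 : 0 < rho.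
  have nd0 : 0 < `|d t| by rewrite normr_gt0 lt_eqF.
  by rewrite lt_min alpha_gt0 andbT; apply: divr_gt0 p_gt0; exact: mulr_gt0.
have rrho i : r i t = - P i * (if e t < b then rho else 0).
  rewrite rE// /unit_rate leNgt dneg -/rho /blocked_rate rho0 andbT.
  by rewrite (ltNge rho 0) (ltW rho0) andbF /=; case: ltP.
(* [rho] is measured per unit of [P i], [lam] per unit of [P' i], hence the factor [alpha]. *)
exists ((b - e t) / alpha), (rho / alpha); split.
  by rewrite divr_gt0// ler_pdivrMr// mul1r ge_min lexx orbT.
have durE i : (P i * b - P i * e t) / P' i = (b - e t) / alpha.
  by rewrite P'E; field; rewrite !gt_eqF.
split=> [i|].
  rewrite rrho EE// [Ebar i]EbarE durE ltxx eqxx andbF andbT ltr_pM2l//.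
  case: (ltP (e t) b) => _; last by rewrite mulr0.
  by rewrite P'E mulNr; congr (- _); field; rewrite gt_eqF.
under eq_bigr do rewrite rrho; rewrite -mulr_suml sumrN mulNr opprK -/p.
rewrite (eq_bigl (fun=> e t < b)); last first.
  by move=> i; rewrite EE// EbarE ltr_pM2l.
case: ifP => _.
  rewrite (eq_bigr _ (fun i _ => P'E i)) -mulr_sumr -/p.
  by rewrite /rho minr_pMr ?ltW// [p * alpha]mulrC [p * _]mulrC divfK// gt_eqF.
by rewrite mulr0 big_pred0_eq min_r// mulr_ge0// ltW.
Qed.

Lemma gg_policy_nonanticipatory_exists :
  exists pigg : (R -> R) -> I -> R -> R, nonanticipatory pigg /\
    forall d, measurable_fun Rnneg d -> gg_policy Ebar P P' eta E0 d (pigg d).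
Proof.
have sol_exists d : exists e : R -> R, measurable_fun Rnneg d -> e 0 = x0 /\
    has_density e (fun t => blocked_rate b (e t) (unit_rate (d t))) (1 + alpha).
  (* A dummy value makes the solution map total. *)
  have [md|nmd] := pselect (measurable_fun Rnneg d); last by exists (cst 0).
  have [e He] := blocked_solution_exists b_gt0 x0_bounds
    (measurable_unit_rate md) (fun t _ => unit_rate_norm (d t)).
  by exists e.
have [sol solP] := choice sol_exists.
(* The chosen solution may depend on the whole demand, so at time [t] it is fed the demand set to
   zero outside [[0, t]]; uniqueness gives the same state at [t]. *)
pose pigg d i t : R := - P i *
  blocked_rate b (sol (fun s => if 0 <= s <= t then d s else 0) t) (unit_rate (d t)).
exists pigg; split.
  move=> d1 d2 t t0 d12 i; rewrite /pigg (d12 t) ?t0 ?lexx//.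
  congr (_ * blocked_rate _ (sol _ _) _); apply/funext => s.
  by case: ifP => // /d12.
move=> d md; have [e0 de] := solP d md.
apply: (gg_policy_of_solution de e0) => i t t0; rewrite /pigg.
have mcut : measurable_fun Rnneg (fun s => if 0 <= s <= t then d s else 0).
  have mcst c : measurable_fun Rnneg (cst c : R -> R) by exact: measurable_cst.
  have mid : measurable_fun Rnneg (id : R -> R) by exact: measurable_id.
  apply: measurable_fun_if => //.
  - exact: measurable_nneg.
  - by apply: measurable_and; exact: measurable_fun_ler.
  - by apply: measurable_funS md => //; exact: measurable_nneg.
have [c0 dc] := solP _ mcut.
congr (_ * blocked_rate _ _ _).
apply: (blocked_solution_unique dc de) => //; first by rewrite c0 e0.
by move=> s st; rewrite st.
Qed.

End Construction.
End Policies.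

(** The integral of a nonnegative function is a supremum over simple functions below it, hence
    monotone for arbitrary functions. Unserved energy under an arbitrary policy need not depend
    measurably on the outcome. *)
Lemma ge0_le_integral_nomeas d (T : measurableType d) (R : realType)
    (mu : {measure set T -> \bar R}) (f g : T -> \bar R) :
  (forall x, 0 <= f x)%E -> (forall x, f x <= g x)%E ->
  (\int[mu]_x f x <= \int[mu]_x g x)%E.
Proof.
move=> f0 fg; rewrite /integral /= !patch_setT.
have g0 x : (0 <= g x)%E by exact: le_trans (fg x).
have neg0 (h : T -> \bar R) : (forall x, 0 <= h x)%E -> h^\-%E = cst 0%E.
  move=> h0; apply/funext => x.
  by apply: (@ge0_funenegE _ _ setT) => //; rewrite in_setT.
have pos (h : T -> \bar R) : (forall x, 0 <= h x)%E -> h^\+%E = h.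
  move=> h0; apply/funext => x.
  by apply: (@ge0_funeposE _ _ setT) => //; rewrite in_setT.
rewrite !neg0// !pos//; apply: leeD2r; apply: le_ereal_sup => _ [h hf <-].
by exists h => // x; exact: le_trans (fg x).
Qed.

Theorem theorem5 (R : realType) (I : finType) (Ebar P P' E0 : I -> R)
  (alpha eta : R)
  (dm : measure_display) (Omega : measurableType dm)
  (Pr : probability Omega R) (D : Omega -> R -> R) :
  (forall i, 0 < Ebar i) -> (forall i, 0 < P i) ->
  0 < alpha -> (forall i, P' i = alpha * P i) ->
  0 < eta <= 1 ->
  (forall i j, Ebar i / P i = Ebar j / P j) ->
  (forall i j, E0 i / P i = E0 j / P j) ->
  (forall i, 0 <= E0 i <= Ebar i) ->
  (* deterministic part: for every horizon and locally integrable demand,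
     the GGDDF/GGCDF policy exists, is admissible, and minimises the
     unserved energy among all admissible policies *)
  (forall (T : \bar R) (d : R -> R), (0 < T)%E -> loc_integrable d ->
     (exists r, gg_policy Ebar P P' eta E0 d r) /\
     forall r, gg_policy Ebar P P' eta E0 d r ->
       admissible Ebar P P' eta E0 d r /\
       forall r', admissible Ebar P P' eta E0 d r' ->
         (unserved T d r <= unserved T d r')%E) /\
  (* the GGDDF/GGCDF policy is non-anticipatory *)
  (exists pigg : (R -> R) -> I -> R -> R, nonanticipatory pigg /\
     forall d, loc_integrable d -> gg_policy Ebar P P' eta E0 d (pigg d)) /\
  (* random demand: minimal expected unserved energy among all
     non-anticipatory admissible policies *)
  ((forall w, loc_integrable (D w)) ->
   forall (T : \bar R), (0 < T)%E ->
   forall pigg : (R -> R) -> I -> R -> R,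
     (forall w, gg_policy Ebar P P' eta E0 (D w) (pigg (D w))) ->
   forall pi : (R -> R) -> I -> R -> R, nonanticipatory pi ->
     (forall w, admissible Ebar P P' eta E0 (D w) (pi (D w))) ->
     (\int[Pr]_(w in setT) unserved T (D w) (pigg (D w))
        <= \int[Pr]_(w in setT) unserved T (D w) (pi (D w)))%E).
Proof.
move=> Ebar_gt0 P_gt0 alpha_gt0 P'E eta01 Ebar_prop E0_prop E0_bounds.
have [pigg [na_pigg gg_pigg]] : exists pigg : (R -> R) -> I -> R -> R,
    nonanticipatory pigg /\
    forall d, loc_integrable d -> gg_policy Ebar P P' eta E0 d (pigg d).
  have [i0 _|I0] := pickP (fun _ : I => true).
    have [pigg [na_pigg gg_pigg]] := gg_policy_nonanticipatory_exists
      Ebar_gt0 P_gt0 alpha_gt0 P'E eta01 Ebar_prop E0_prop E0_bounds i0.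
    exists pigg; split=> // d /loc_integrable_measurable; exact: gg_pigg.
  (* With no stores every sum is empty, and any threshold and fraction will do. *)
  exists (fun _ _ _ => 0); split=> // d intd; split=> [i|t t0].
    by have := I0 i.
  split=> dt; exists 0, 1; rewrite ltr01 lexx; split=> //; split.
  - by move=> i; have := I0 i.
  - by rewrite !big_pred0// ?min_r// => i; have := I0 i.
  - by move=> i; have := I0 i.
  - rewrite !big_pred0 => [|i|i]; try by have := I0 i.
    have eta_ge0 : 0 <= eta by case/andP: eta01 => eta0 _; exact: ltW.
    by rewrite oppr0 min_r// mulr_ge0.
have optimal T d r : (0 < T)%E -> loc_integrable d ->
    gg_policy Ebar P P' eta E0 d r -> admissible Ebar P P' eta E0 d r /\
    forall r', admissible Ebar P P' eta E0 d r' ->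
      (unserved T d r <= unserved T d r')%E.
  move=> T0 intd ggr; split; first exact: (gg_admissible P_gt0 alpha_gt0 P'E eta01 E0_bounds ggr).
  move=> r' adm; exact: (gg_optimal Ebar_gt0 P_gt0 alpha_gt0 P'E eta01 Ebar_prop
    E0_prop E0_bounds ggr).
split; [|split].
- move=> T d T0 intd; split; first by exists (pigg d); exact: gg_pigg.
  by move=> r; exact: optimal.
- by exists pigg.
- move=> intD T T0 pi1 gg_pi1 pi _ adm.
  (* The deterministic bound holds outcome by outcome. *)
  apply: ge0_le_integral_nomeas => w; last exact: (optimal _ _ _ T0 _ _).2.
  by apply: integral_ge0 => s _; rewrite lee_fin le_max lexx orbT.
Qed.
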